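(* Let $\omega=\{\omega(n)\}_{n\ge 0}$ be any sequence with $0<\omega(n)$ nondecreasing and $\omega(n)\to\infty$. Then there exists a function $f$ in the Wiener algebra $A(\mathbb{T})=\{f:\sum_{n\in\mathbb{Z}}|\widehat f(n)|<\infty\}$ which cannot be written as $f=g+h$ with $g\in\mathrm{PLA}$ and $h\in\mathcal{H}_\omega$. In particular $\mathrm{PLA}+\mathcal{H}_\omega\neq L^0(\mathbb{T})$ and $\mathrm{PLA}+\mathcal{H}_\omega\not\supseteq A(\mathbb{T})$.
   Context: $\mathbb{T}=\mathbb{R}/2\pi\mathbb{Z}$ with Lebesgue measure. $L^0(\mathbb{T})$ is the space of measurable, almost everywhere finite functions on $\mathbb{T}$ (modulo a.e. equality). $\mathrm{PLA}$ denotes the set of measurable functions $g$ on $\mathbb{T}$ for which there exist complex numbers $c(n)$, $n\ge 0$, such that the partial sums $\sum_{0\le n<N}c(n)e^{int}$ converge to $g(t)$ as $N\to\infty$ for almost every $t$. $\mathcal{H}_\omega=\{h\in L^2(\mathbb{T}):\sum_{n\in\mathbb{Z}}|\widehat h(n)|^2\omega(|n|)^2<\infty\}$, where $\widehat h(n)$ are the Fourier coefficients. $\mathrm{PLA}+\mathcal{H}_\omega=\{g+h: g\in\mathrm{PLA},h\in\mathcal{H}_\omega\}$. *)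

(* Defs.v *)
From HB Require Import structures.
From mathcomp Require Import all_boot all_order all_algebra.
From mathcomp Require Import all_classical all_reals all_analysis.
From mathcomp Require Import complex.
Set Implicit Arguments. Unset Strict Implicit. Unset Printing Implicit Defensive.
Import Order.TTheory GRing.Theory Num.Theory.
Import numFieldNormedType.Exports.
Local Open Scope ring_scope.
Local Open Scope classical_set_scope.

Section Defs.
Context {R : realType}.

(* The circle T = R / 2piZ is represented by the fundamental domain [0, 2pi]
   (the endpoint is a null set), with Lebesgue measure. *)
Definition Tset : set R := `[0, 2 * pi]%classic.
Definition muT := (@lebesgue_measure R).

Definition expi (n : int) (t : R) : R[i] :=
  Complex (cos (n%:~R * t)) (sin (n%:~R * t)).

Definition cmod (z : R[i]) : R := Num.sqrt (complex.Re z ^+ 2 + complex.Im z ^+ 2).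

Definition cmeasurable (f : R -> R[i]) : Prop :=
  measurable_fun Tset (fun t => complex.Re (f t)) /\
  measurable_fun Tset (fun t => complex.Im (f t)).

Definition L1T (f : R -> R[i]) : Prop :=
  cmeasurable f /\ muT.-integrable Tset (fun t => (cmod (f t))%:E).

Definition L2T (f : R -> R[i]) : Prop :=
  cmeasurable f /\ muT.-integrable Tset (fun t => (cmod (f t) ^+ 2)%:E).

Definition fourier_coef (f : R -> R[i]) (n : int) : R[i] :=
  Complex
    ((2 * pi)^-1 * Rintegral muT Tset (fun t => complex.Re (f t * expi (- n) t)))
    ((2 * pi)^-1 * Rintegral muT Tset (fun t => complex.Im (f t * expi (- n) t))).

(* \sum_{n in Z} a(n) < oo, for a nonnegative family a indexed by Z *)
Definition summableZ (a : int -> R) : Prop :=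
  cvgn ((fun N : nat => \sum_(0 <= k < N) (a (k%:Z) + a (- (k.+1)%:Z))) : R^nat).

Definition wiener (f : R -> R[i]) : Prop :=
  L1T f /\ summableZ (fun n => cmod (fourier_coef f n)).

Definition psum (c : nat -> R[i]) (N : nat) (t : R) : R[i] :=
  \sum_(0 <= n < N) c n * expi n%:Z t.

Definition PLA (g : R -> R[i]) : Prop :=
  cmeasurable g /\
  exists c : nat -> R[i],
    {ae muT, forall t, Tset t ->
       ((fun N => complex.Re (psum c N t)) @ \oo --> complex.Re (g t)) /\
       ((fun N => complex.Im (psum c N t)) @ \oo --> complex.Im (g t))}.

Definition H_omega (omega : nat -> R) (h : R -> R[i]) : Prop :=
  L2T h /\
  summableZ (fun n => cmod (fourier_coef h n) ^+ 2 * omega `|n|%N ^+ 2).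

End Defs.

(* Main.v *)
(* The function is f = sum_k a_k e^{-i nu_k t}, with a_k tending to 0 very fast
   and nu_k growing very fast in terms of omega.  Suppose f = g + h.  Fix k large
   and let Q be the Fourier partial sum of h of degree m_k < nu_k; the growth of
   omega makes h - Q tiny off a small set.  If S_N are the partial sums of g, then
     P(z) = z^{nu_k} (S_N(z) + Q(z) - sum_{i<k} a_i z^{-nu_i})
   is a polynomial vanishing at 0 which, for suitable N, is very close to a_k on a
   set E of measure at least 2 pi (1 - eps), with an absolute eps.  By Egorov's
   theorem the sums S_N are bounded on E uniformly in N, so Abel summation bounds
   them on the cones with vertices in E; the term z^{nu_k} Q is controlled by the
   harmonic extension of |Q|^2.  Comparing log |P - a_k| on the union of the cones
   with a multiple of the harmonic measure of the complement of E (two-constants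
   theorem) gives at the origin an upper bound for log a_k which is too small. *)
Require Import Defs.
From HB Require Import structures.
From mathcomp Require Import all_boot all_order all_algebra.
From mathcomp Require Import all_classical all_reals all_analysis.
From mathcomp Require Import complex.
From mathcomp Require Import measurable_realfun ring lra zify.
Import Order.TTheory GRing.Theory Num.Theory.
Import numFieldNormedType.Exports.
Local Open Scope ring_scope.
Local Open Scope classical_set_scope.
Local Open Scope complex_scope.
Set Implicit Arguments. Unset Strict Implicit. Unset Printing Implicit Defensive.
Local Notation "x ^*" := (@conjc _ x) : ring_scope.

(** * Moduli and exponentials *)

Section cmod.
Context {R : realType}.
Implicit Types (z w : R[i]) (x y : R).

(** The order of choices shapes the proof: f is fixed before g and h, whose sizes (a bound M for the
    partial sums on E, a bound u for the sum of |hat h(n)|^2) are then unknown. So stage k is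
    prepared for all pairs with M and u at most k: the accuracy beta_k depends only on k and a_k,
    the next amplitude on beta_k, the degree m_k on beta_k and omega. Given g and h are refuted at a
    single large k. A sup bound for Q would be circular, since it grows with m_k and hence with the
    choice of beta_k; the harmonic majorant of |Q|^2 has value at most u at the origin whatever m_k
    is. The exponents dictate eps. Let w approximate the harmonic measure of the arcs missing E. A
    weight exp(-A w) gains exp(-A/500) on the line w = 1/500 and loses at most exp(-2 A eps) at the
    origin, so eps < 1/1000 is required and 1/2000 is taken. A large A then beats every constant,
    and beta is chosen after A. No logarithm or harmonic measure of a domain occurs: all functions
    are polynomials, and the union of the cones is replaced by its subset |z| <= r, Re w <=
    1/500. *)

Lemma cmodE z : (cmod z)%:C = `|z|.
Proof. by rewrite normc_def. Qed.

Lemma cmod_ge0 z : 0 <= cmod z.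
Proof. exact: sqrtr_ge0. Qed.

Lemma sqr_cmod z : cmod z ^+ 2 = complex.Re z ^+ 2 + complex.Im z ^+ 2.
Proof. by rewrite sqr_sqrtr // addr_ge0 ?sqr_ge0. Qed.

Lemma cmodM z w : cmod (z * w) = cmod z * cmod w.
Proof. by apply: complexI; rewrite rmorphM /= !cmodE normrM. Qed.

Lemma cmodX z n : cmod (z ^+ n) = cmod z ^+ n.
Proof. by apply: complexI; rewrite rmorphXn /= !cmodE normrX. Qed.

Lemma cmodN z : cmod (- z) = cmod z.
Proof. by apply: complexI; rewrite !cmodE normrN. Qed.

Lemma cmodB z w : cmod (z - w) = cmod (w - z).
Proof. by rewrite -cmodN opprB. Qed.

Lemma cmod0 : cmod (0 : R[i]) = 0.
Proof. by apply: complexI; rewrite cmodE normr0. Qed.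

Lemma cmod1 : cmod (1 : R[i]) = 1.
Proof. by apply: complexI; rewrite cmodE normr1. Qed.

Lemma cmodD z w : cmod (z + w) <= cmod z + cmod w.
Proof. by rewrite -lecR rmorphD /= !cmodE ler_normD. Qed.

Lemma cmodBD z w : cmod (z - w) <= cmod z + cmod w.
Proof. by rewrite -(cmodN w) cmodD. Qed.

Lemma cmodBT v z w : cmod (z - w) <= cmod (z - v) + cmod (v - w).
Proof. by rewrite -[z - w](subrKA v) cmodD. Qed.

Lemma cmod_sum (I : Type) (r : seq I) (P : pred I) (F : I -> R[i]) :
  cmod (\sum_(i <- r | P i) F i) <= \sum_(i <- r | P i) cmod (F i).
Proof.
elim/big_rec2: _ => [|i y z _ le_yz]; first by rewrite cmod0.
by rewrite (le_trans (cmodD _ _))// lerD2l.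
Qed.

Lemma cmod_real x : cmod x%:C = `|x|.
Proof. by rewrite /cmod /= expr0n /= addr0 sqrtr_sqr. Qed.

Lemma ger0_cmod x : 0 <= x -> cmod x%:C = x.
Proof. by move=> x0; rewrite cmod_real ger0_norm. Qed.

Lemma cmodJ z : cmod z^* = cmod z.
Proof. by case: z => a b; rewrite /cmod /= sqrrN. Qed.

Lemma normr_Re_le z : `|complex.Re z| <= cmod z.
Proof. by rewrite -lecR cmodE normc_ge_Re. Qed.

Lemma Re_le_cmod z : complex.Re z <= cmod z.
Proof. exact: le_trans (ler_norm _) (normr_Re_le z). Qed.

Lemma normr_Im_le z : `|complex.Im z| <= cmod z.
Proof. by rewrite /cmod -sqrtr_sqr ler_wsqrtr// lerDr sqr_ge0. Qed.

Lemma cmod_le_ReIm z : cmod z <= `|complex.Re z| + `|complex.Im z|.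
Proof.
rewrite -[leRHS]ger0_norm ?addr_ge0 // -sqrtr_sqr ler_wsqrtr//.
rewrite sqrrD -!normrX !(ger0_norm (sqr_ge0 _)) -addrA lerD2l lerDr.
by rewrite mulrn_wge0// mulr_ge0.
Qed.

Lemma mulcJ z : z * z^* = (cmod z ^+ 2)%:C.
Proof. by rewrite rmorphXn /= cmodE sqr_normc. Qed.

Lemma ReD z w : complex.Re (z + w) = complex.Re z + complex.Re w.
Proof. by case: z w => a b []. Qed.
Lemma ImD z w : complex.Im (z + w) = complex.Im z + complex.Im w.
Proof. by case: z w => a b []. Qed.
Lemma ReN z : complex.Re (- z) = - complex.Re z.
Proof. by case: z. Qed.
Lemma ImN z : complex.Im (- z) = - complex.Im z.
Proof. by case: z. Qed.
Lemma ReM z w : complex.Re (z * w) =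
  complex.Re z * complex.Re w - complex.Im z * complex.Im w.
Proof. by case: z w => a b []. Qed.
Lemma ImM z w : complex.Im (z * w) =
  complex.Re z * complex.Im w + complex.Im z * complex.Re w.
Proof. by case: z w => a b []. Qed.
Lemma ReZ x z : complex.Re (x%:C * z) = x * complex.Re z.
Proof. by rewrite ReM /= mul0r subr0. Qed.
Lemma ImZ x z : complex.Im (x%:C * z) = x * complex.Im z.
Proof. by rewrite ImM /= mul0r addr0. Qed.

Lemma Re_sum (I : Type) (r : seq I) (P : pred I) (F : I -> R[i]) :
  complex.Re (\sum_(i <- r | P i) F i) = \sum_(i <- r | P i) complex.Re (F i).
Proof. by elim/big_rec2: _ => // i y z _; rewrite ReD => ->. Qed.
Lemma sqr_cmodD z w : cmod (z + w) ^+ 2 =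
  cmod z ^+ 2 + 2 * complex.Re (z^* * w) + cmod w ^+ 2.
Proof. by rewrite !sqr_cmod; case: z w => a b [c d] /=; ring. Qed.

End cmod.

Section expi.
Context {R : realType}.
Implicit Types (t : R) (n m : int).

Lemma expi0 t : expi 0 t = 1.
Proof. by rewrite /expi mul0r cos0 sin0. Qed.

Lemma expiD n m t : expi (n + m) t = expi n t * expi m t.
Proof.
rewrite /expi intrD mulrDl cosD sinD.
by apply/eqP; rewrite eq_complex /= eqxx /=; apply/eqP; ring.
Qed.

Lemma expiN n t : expi (- n) t = (expi n t)^*.
Proof. by rewrite /expi rmorphN mulNr cosN sinN. Qed.

Lemma cmod_expi n t : cmod (expi n t) = 1.
Proof. by rewrite /cmod /= cos2Dsin2 sqrtr1. Qed.

Lemma expiX n k t : expi (n * k%:Z) t = expi n t ^+ k.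
Proof.
elim: k => [|k IHk]; first by rewrite mulr0 expi0.
by rewrite intS mulrDr mulr1 expiD IHk exprS.
Qed.

Lemma expi_nat k t : expi k%:Z t = expi 1 t ^+ k.
Proof. by rewrite -expiX mul1r. Qed.

Lemma expi_mulN n t : expi n t * expi (- n) t = 1.
Proof. by rewrite -expiD subrr expi0. Qed.

End expi.

(** * Polynomials on discs and the maximum principle *)

Section polynomials_on_discs.
Context {R : realType}.
Implicit Types (p q T W : {poly R[i]}) (z w : R[i]) (r : R).

Lemma poly_bounded p r : 0 <= r ->
  exists2 B, 0 <= B & forall z, cmod z <= r -> cmod p.[z] <= B.
Proof.
move=> r0; elim/poly_ind: p => [|p c [B B0 pB]].
  by exists 0 => // z _; rewrite horner0 cmod0.
exists (B * r + cmod c) => [|z zr]; first by rewrite addr_ge0 ?mulr_ge0 ?cmod_ge0.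
rewrite hornerMXaddC (le_trans (cmodD _ _))// lerD2r cmodM.
by rewrite ler_pM ?cmod_ge0 ?pB.
Qed.

Lemma poly_lipschitz p r : 0 <= r -> exists2 B, 0 <= B &
  forall z w, cmod z <= r -> cmod w <= r -> cmod (p.[z] - p.[w]) <= B * cmod (z - w).
Proof.
move=> r0; elim/poly_ind: p => [|p c [B B0 pB]].
  by exists 0 => // z w _ _; rewrite !horner0 subrr cmod0 mul0r.
have [D D0 pD] := poly_bounded p r0.
exists (B * r + D) => [|z w zr wr]; first by rewrite addr_ge0 ?mulr_ge0.
have -> : (p * 'X + c%:P).[z] - (p * 'X + c%:P).[w] =
    (p.[z] - p.[w]) * z + p.[w] * (z - w) by rewrite !hornerMXaddC; ring.
rewrite (le_trans (cmodD _ _))// !cmodM mulrDl lerD ?ler_wpM2r ?cmod_ge0 ?pD//.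
by rewrite mulrAC ler_pM ?cmod_ge0 ?pB.
Qed.

Lemma expi_neq1 (t : R) : 0 < t < 2 * pi -> expi 1 t != 1.
Proof.
move=> /andP[t0 tpi]; apply/eqP => /(congr1 (@complex.Re R)) /=; rewrite mul1r.
have -> : t = (t / 2) *+ 2 by rewrite mulr2n; lra.
have : 0 < sin (t / 2) by apply: sin_gt0_pi; lra.
move=> s0; rewrite cos_mulr2n cos2sin2; nra.
Qed.

Definition unity_pt (n j : nat) : R[i] := expi 1 (2 * pi * j%:R / n%:R).

Lemma cmod_unity_pt n j : cmod (unity_pt n j) = 1.
Proof. exact: cmod_expi. Qed.

Lemma unity_ptX n j k : unity_pt n j ^+ k = unity_pt n k ^+ j.
Proof.
rewrite /unity_pt -!expi_nat /expi -!pmulrn.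
by have -> : k%:R * (2 * pi * j%:R / n%:R) = j%:R * (2 * pi * k%:R / n%:R) :> R by ring.
Qed.

Lemma unity_ptn n : (0 < n)%N -> unity_pt n n = 1.
Proof.
move=> n0; rewrite /unity_pt mulfK ?pnatr_eq0 -?lt0n // /expi !mul1r mulr_natl.
by rewrite cos2pi sin2pi.
Qed.

(** By [unity_ptX] the sum is geometric with ratio [unity_pt n k], which differs from 1 and has n-th
    power 1. *)
Lemma sum_unity_ptX n k : (0 < k < n)%N -> \sum_(j < n) unity_pt n j ^+ k = 0.
Proof.
move=> /andP[k0 kn]; have n0 : (0 < n)%N by apply: leq_ltn_trans kn.
have nk1 : unity_pt n k != 1.
  apply: expi_neq1; rewrite !divr_gt0 ?mulr_gt0 ?pi_gt0 ?ltr0n//=.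
  by rewrite ltr_pdivrMr ?ltr0n// ltr_pM2l ?ltr_nat// mulr_gt0 ?pi_gt0.
under eq_bigr => j _ do rewrite unity_ptX.
apply: (mulfI (_ : unity_pt n k - 1 != 0)); first by rewrite subr_eq0.
by rewrite -subrX1 unity_ptX unity_ptn// expr1n subrr mulr0.
Qed.

(** An exact quadrature form of the mean value property: with at least [size T] nodes all
    nonconstant powers cancel, so circle integrals are avoided. *)
Lemma mean_value T z (rho : R) n : (size T <= n)%N -> (0 < n)%N ->
  \sum_(j < n) T.[z + rho%:C * unity_pt n j] = n%:R * T.[z].
Proof.
move=> sT n0; pose Q := T \Po ('X + z%:P).
have QE w : T.[z + w] = Q.[w] by rewrite horner_comp !hornerE addrC.
have sQ : (size Q <= n)%N.
  by rewrite size_comp_poly2 // size_XaddC.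
rewrite -{2}[z]addr0 QE; under eq_bigr => j _ do rewrite QE (horner_coef_wide _ sQ).
rewrite exchange_big /= (horner_coef_wide _ sQ).
case: n n0 sT sQ => // n _ _ _; rewrite !big_ord_recl /= !expr0 !mulr1.
rewrite [X in _ + X = _]big1 => [|i _]; last first.
  under eq_bigr do rewrite exprMn.
  rewrite -mulr_sumr -mulr_sumr sum_unity_ptX ?mulr0 //=.
  by rewrite /bump add1n ltnS ltn_ord.
rewrite [X in _ = _ * (_ + X)]big1 => [|i _]; last by rewrite exprS mul0r mulr0.
by rewrite !addr0 sumr_const card_ord mulr_natl mulrS.
Qed.

Lemma continuous_ReIm_horner p :
  continuous (fun v : R * R => complex.Re p.[Complex v.1 v.2]) /\
  continuous (fun v : R * R => complex.Im p.[Complex v.1 v.2]).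
Proof.
elim/poly_ind: p => [|p c [cR cI]].
  by split=> v; under eq_fun do rewrite horner0; exact: cvg_cst.
split=> v.
  under eq_fun do rewrite hornerMXaddC ReD ReM /=.
  apply: cvgD; last exact: cvg_cst.
  by apply: cvgB; apply: cvgM; [exact: cR|exact: cvg_fst|exact: cI|exact: cvg_snd].
under eq_fun do rewrite hornerMXaddC ImD ImM /=.
apply: cvgD; last exact: cvg_cst.
by apply: cvgD; apply: cvgM; [exact: cR|exact: cvg_snd|exact: cI|exact: cvg_fst].
Qed.

(* A maximum point of |T|^2 + eta |z|^2 over the region cannot be interior: the
   average of this function over a small circle strictly exceeds its value at
   the centre. *)
Lemma max_principle T W r (c beta : R) : 0 < r -> 0 <= beta ->
  (forall z, cmod z <= r -> complex.Re W.[z] <= c ->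
     cmod z = r \/ complex.Re W.[z] = c -> cmod T.[z] <= beta) ->
  forall z, cmod z <= r -> complex.Re W.[z] <= c -> cmod T.[z] <= beta.
Proof.
move=> r0 beta0 bdT z1 z1r z1c.
(* The term in eta only serves to make averages strictly larger; it is removed here by letting eta
   tend to 0. *)
suff key eta : 0 < eta -> cmod T.[z1] ^+ 2 <= beta ^+ 2 + eta * r ^+ 2.
  rewrite -(@ler_pXn2r _ 2) ?nnegrE ?cmod_ge0//.
  apply/ler_addgt0Pr => e e0.
  have := key (e / r ^+ 2) (divr_gt0 e0 (exprn_gt0 2 r0)).
  by rewrite divfK ?gt_eqF ?exprn_gt0.
move=> eta0; pose toC (v : R * R) := Complex v.1 v.2.
pose Phi z := cmod T.[z] ^+ 2 + eta * cmod z ^+ 2.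
pose A := (`[- r, r] `*` `[- r, r]) `&` [set v : R * R | cmod (toC v) ^+ 2 <= r ^+ 2]
   `&` [set v | complex.Re W.[toC v] <= c].
have AE z : cmod z <= r -> complex.Re W.[z] <= c -> A (complex.Re z, complex.Im z).
  case: z => x y /= zr zc; split; [split|] => //=; last first.
    by rewrite /toC /= ler_pXn2r // nnegrE ?cmod_ge0// ltW.
  by rewrite !in_itv /= -!ler_norml; split;
    apply: le_trans zr; [have := normr_Re_le (Complex x y)|have := normr_Im_le (Complex x y)].
have cn : continuous (fun v => cmod (toC v) ^+ 2).
  move=> v; under eq_fun do rewrite sqr_cmod /= !expr2.
  by apply: cvgD; apply: cvgM; (exact: cvg_fst || exact: cvg_snd).
have cPhi : continuous (Phi \o toC).
  move=> v; rewrite /Phi /comp; have [cR cI] := continuous_ReIm_horner T.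
  apply: cvgD; last by apply: cvgM; [exact: cvg_cst|exact: cn].
  rewrite sqr_cmod; under eq_fun do rewrite sqr_cmod.
  rewrite !expr2; under eq_fun do rewrite !expr2.
  by apply: cvgD; apply: cvgM; (exact: cR || exact: cI).
have A0 : A !=set0 by exists (complex.Re z1, complex.Im z1); exact: AE.
have cptA : compact A.
  apply: compact_closedI; [apply: compact_closedI|].
  - by apply: compact_setX; exact: segment_compact.
  - exact: (closed_comp (fun v _ => cn v) (@closed_le R _)).
  - by apply: (closed_comp _ (@closed_le R _)) => v _; exact: (continuous_ReIm_horner W).1.
have [v0 /set_mem Av0 maxv0] := compact_EVT_max A0 cptA (continuous_subspaceT cPhi).
have maxP z : cmod z <= r -> complex.Re W.[z] <= c -> Phi z <= Phi (toC v0).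
  move=> zr zc; have := maxv0 _ (mem_set (AE z zr zc)); rewrite /comp /toC /=.
  by case: (z).
have v0r : cmod (toC v0) <= r.
  by case: Av0 => -[_ /=]; rewrite ler_pXn2r // nnegrE ?cmod_ge0// ltW.
have v0c : complex.Re W.[toC v0] <= c by case: Av0.
set z0 := toC v0 in v0r v0c maxP.
have bnd : cmod z0 = r \/ complex.Re W.[z0] = c -> cmod T.[z1] ^+ 2 <= beta ^+ 2 + eta * r ^+ 2.
  move=> b; apply: (@le_trans _ _ (Phi z1)).
    by rewrite lerDl mulr_ge0 ?sqr_ge0// ltW.
  rewrite (le_trans (maxP z1 z1r z1c))// lerD// ?ler_wpM2l ?(ltW eta0)// ler_pXn2r// ?nnegrE ?cmod_ge0 ?(ltW r0)//.
  exact: bdT.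
have [zr|zr] := eqVneq (cmod z0) r; first by apply: bnd; left.
have [zc|zc] := eqVneq (complex.Re W.[z0]) c; first by apply: bnd; right.
have {zr v0r}z0r : cmod z0 < r by rewrite lt_neqAle zr.
have {zc v0c}z0c : complex.Re W.[z0] < c by rewrite lt_neqAle zc.
have [B B0 BW] := poly_lipschitz W (ltW r0).
(* The radius keeps the whole circle in the region: the first bound handles the disc, the second the
   constraint on [W], through its Lipschitz constant. *)
pose rho := Num.min (r - cmod z0) ((c - complex.Re W.[z0]) / (B + 1)).
have rho0 : 0 < rho by rewrite lt_min subr_gt0 z0r /= divr_gt0 ?subr_gt0 ?ltr_wpDl.
(* Enough nodes for [mean_value] to apply both to [T] and to 'X, whose size is 2. *)
pose n := (size T).+2.
have ptK j : let z := z0 + rho%:C * unity_pt n j in cmod z <= r /\ complex.Re W.[z] <= c.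
  move=> z; have cz : cmod (z - z0) = rho.
    by rewrite addrC addKr cmodM cmod_unity_pt mulr1 ger0_cmod// ltW.
  have zr : cmod z <= r.
    rewrite -(subrK z0 z) (le_trans (cmodD _ _))// cz -lerBrDr.
    by rewrite /rho ge_min lexx.
  split=> //; rewrite -(subrK W.[z0] W.[z]) ReD -lerBrDr.
  rewrite (le_trans (Re_le_cmod _))// (le_trans (BW _ _ zr (ltW z0r)))// cz.
  rewrite (@le_trans _ _ ((B + 1) * rho))// ?ler_wpM2r ?lerDl// ?(ltW rho0)//.
  by rewrite mulrC -ler_pdivlMr ?ltr_wpDl// /rho ge_min lexx orbT.
have : \sum_(j < n) Phi (z0 + rho%:C * unity_pt n j) <= \sum_(j < n) Phi z0.
  by apply: ler_sum => j _; have [] := ptK j; exact: maxP.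
(* Both squares are expanded around z0. The linear terms average to 0 by [mean_value]; for [T] the
   quadratic remainder is dropped, for z it is exactly rho^2, so the mean of [Phi] exceeds [Phi z0]
   by at least eta rho^2. *)
have lowT (j : 'I_n) : cmod T.[z0] ^+ 2 +
    2 * complex.Re (T.[z0]^* * (T.[z0 + rho%:C * unity_pt n j] - T.[z0])) <=
    cmod T.[z0 + rho%:C * unity_pt n j] ^+ 2.
  set x := T.[_ + _]; rewrite -[in leRHS](subrKC T.[z0] x) sqr_cmodD lerDl sqr_ge0 //.
have lowz (j : 'I_n) : cmod (z0 + rho%:C * unity_pt n j) ^+ 2 =
    cmod z0 ^+ 2 + 2 * complex.Re (z0^* * (z0 + rho%:C * unity_pt n j - z0)) + rho ^+ 2.
  by rewrite sqr_cmodD [z0 + _ - z0]addrC addKr cmodM cmod_unity_pt mulr1 ger0_cmod// ltW.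
have sum0 (Q : {poly R[i]}) : (size Q <= n)%N ->
    \sum_(j < n) complex.Re (Q.[z0]^* * (Q.[z0 + rho%:C * unity_pt n j] - Q.[z0])) = 0.
  move=> sQ; rewrite -Re_sum -mulr_sumr sumrB mean_value //.
  by rewrite sumr_const card_ord mulr_natl subrr mulr0.
have sX : (size ('X : {poly R[i]}) <= n)%N by rewrite size_polyX.
rewrite leNgt => /negP[]; rewrite /Phi !big_split /= -!(mulr_sumr _ _ _ eta).
under [X in _ < _ + _ * X]eq_bigr do rewrite lowz.
have sX0 : \sum_(j < n) complex.Re (z0^* * (z0 + rho%:C * unity_pt n j - z0)) = 0.
  by rewrite -[RHS](sum0 'X sX); apply: eq_bigr => j _; rewrite !hornerX.
rewrite big_split /= big_split /= -[X in _ < _ + _ * (_ + X + _)]mulr_sumr sX0 mulr0 addr0.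
apply: ler_ltD.
  apply: le_trans (ler_sum _ (fun j _ => lowT j)).
  by rewrite big_split /= -[X in _ <= _ + X]mulr_sumr sum0 ?mulr0 ?addr0// /n (leq_trans (leqnSn _)).
by rewrite ltr_pM2l// ltrDl sumr_const card_ord mulrn_wgt0// exprn_gt0.
Qed.

End polynomials_on_discs.

(** * Majorants and the truncated Herglotz kernel *)

Section majorants.
Context {R : realType}.
Implicit Types (z w : R[i]) (b : nat -> R[i]).

(* Horner induction on |b_0 + z p|^2 = |b_0|^2 + 2 Re(conj(b_0) z p) + |z|^2 |p|^2
   produces the harmonic extension of |sum_k b_k z^k|^2 from the unit circle. *)
Lemma sqr_majorant n b : exists q : {poly R[i]},
  (forall z, cmod z <= 1 ->
     cmod (\sum_(k < n) b k * z ^+ k) ^+ 2 <= complex.Re q.[z]) /\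
  q.[0] = (\sum_(k < n) cmod (b k) ^+ 2)%:C.
Proof.
elim: n b => [|n IHn] b.
  exists 0; split=> [z _|]; last by rewrite horner0 big_ord0.
  by rewrite big_ord0 cmod0 horner0 expr0n.
have [q [q_ge q0]] := IHn (b \o succn).
pose p : {poly R[i]} := \sum_(k < n) (b k.+1)%:P * 'X^k.
have pE z : p.[z] = \sum_(k < n) b k.+1 * z ^+ k.
  by rewrite horner_sum; apply: eq_bigr => k _; rewrite !hornerE.
exists (((cmod (b 0%N) ^+ 2)%:C)%:P + (2%:R * (b 0%N)^*)%:P * 'X * p + q).
split=> [z z1|]; last first.
  by rewrite !hornerE q0 big_ord_recl /= rmorphD.
have -> : \sum_(k < n.+1) b k * z ^+ k = b 0%N + z * p.[z].
  rewrite big_ord_recl /= expr0 mulr1 pE mulr_sumr; congr (_ + _).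
  by apply: eq_bigr => k _; rewrite /bump /= exprS mulrCA.
have E : (2%:R * (b 0%N)^*)%:P.[z] * z * p.[z] = 2%:C * ((b 0%N)^* * (z * p.[z])).
  by rewrite hornerC rmorph_nat !mulrA.
rewrite sqr_cmodD !(hornerD, hornerM) hornerX E hornerC !ReD ReZ lerD2l.
apply: le_trans (q_ge z z1); rewrite cmodM exprMn pE.
by rewrite ler_piMl ?sqr_ge0// expr_le1 ?cmod_ge0.
Qed.

(** Summation by parts: with s_k the partial sums at 1, the sum is s_n z^n plus (1 - z) times the
    sum of the s_(k+1) z^k. In a cone with vertex 1 the quotient on the right is bounded. *)
Lemma abel_bound M n b z : 0 <= M -> cmod z < 1 ->
  (forall k, cmod (\sum_(i < k) b i) <= M) ->
  cmod (\sum_(k < n) b k * z ^+ k) <= M * (1 + cmod (1 - z) / (1 - cmod z)).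
Proof.
move=> M0 z1 bM; pose s k := \sum_(i < k) b i.
have sM k : cmod (s k) <= M by exact: bM.
have z0 := cmod_ge0 z; have z1' : 0 < 1 - cmod z by rewrite subr_gt0.
suff key : cmod (\sum_(k < n) b k * z ^+ k - s n * z ^+ n) <=
    M * cmod (1 - z) * \sum_(k < n) cmod z ^+ k.
  rewrite -(subrK (s n * z ^+ n) (\sum_(k < n) _)) (le_trans (cmodD _ _))//.
  rewrite [leLHS]addrC mulrDr mulr1 lerD//.
    rewrite -[leRHS]mulr1 cmodM cmodX ler_pM ?cmod_ge0 ?exprn_ge0 ?sM//.
    by rewrite exprn_ile1// ltW.
  rewrite (le_trans key)// mulrA ler_wpM2l ?mulr_ge0 ?cmod_ge0//.
  rewrite -[leRHS]mul1r ler_pdivlMr// mulrC -opprB mulNr -subrX1 opprB gerBl.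
  by rewrite exprn_ge0.
elim: n => [|n IHn]; first by rewrite !big_ord0 /s big_ord0 mul0r subrr cmod0 mulr0.
rewrite !big_ord_recr /= mulrDr.
have -> : \sum_(i < n) b i * z ^+ i + b n * z ^+ n - s n.+1 * z ^+ n.+1 =
   (\sum_(i < n) b i * z ^+ i - s n * z ^+ n) + s n.+1 * (1 - z) * z ^+ n.
  by rewrite exprS /s big_ord_recr /=; ring.
rewrite (le_trans (cmodD _ _))// lerD// !cmodM cmodX.
by rewrite ler_wpM2r ?exprn_ge0// ler_wpM2r ?cmod_ge0.
Qed.

(* the Taylor polynomial of (1 + z) / (1 - z) *)
Definition herglotz (J : nat) : {poly R[i]} := 1 + 2%:R *: \sum_(k < J) 'X^(k.+1).

(** The real part of (1 + z) / (1 - z) is the Poisson kernel (1 - |z|^2) / |1 - z|^2, and the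
    truncation error 2 z^(J+1) / (1 - z) is at most 2 r^(J+1) / (1 - r), hence at most tau. *)
Lemma herglotz_ge J z r tau : cmod z <= r -> r < 1 -> 2 * r ^+ J.+1 <= tau * (1 - r) ->
  (1 - cmod z ^+ 2) / cmod (1 - z) ^+ 2 - tau <= complex.Re (herglotz J).[z].
Proof.
move=> zr r1 tauP; have z0 := cmod_ge0 z.
have z1 : cmod z < 1 by lra.
have d0 : 1 - r <= cmod (1 - z).
  by have := cmodD (1 - z) z; rewrite subrK cmod1; lra.
have d0' : 0 < cmod (1 - z) by lra.
have E : (herglotz J).[z] * (1 - z) = 1 + z - 2%:R * z ^+ J.+1.
  rewrite /herglotz hornerD hornerZ horner_sum hornerC.
  under eq_bigr do rewrite hornerXn exprS.
  rewrite -mulr_sumr mulrDl mul1r.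
  have -> : 2%:R * (z * \sum_(i < J) z ^+ i) * (1 - z) =
     - (2%:R * z * ((z - 1) * \sum_(i < J) z ^+ i)) by ring.
  by rewrite -subrX1 exprS; ring.
have := congr1 (fun x => complex.Re (x * (1 - z)^*)) E.
rewrite -mulrA mulcJ (mulrC _ (real_complex _ _)) ReZ => E1.
rewrite lerBlDr -[leRHS](@mulKf _ (cmod (1 - z) ^+ 2)) ?sqrf_eq0 ?gt_eqF//.
rewrite mulrC ler_pM2l ?invr_gt0 ?exprn_gt0// mulrDr E1.
have -> : complex.Re ((1 + z - 2%:R * z ^+ J.+1) * (1 - z)^*) =
  1 - cmod z ^+ 2 - 2 * complex.Re (z ^+ J.+1 * (1 - z)^*).
  rewrite mulrBl -mulrA ReD ReN; congr (_ - _).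
    by rewrite sqr_cmod; case: (z) => a b /=; ring.
  by have := ReZ 2 (z ^+ J.+1 * (1 - z)^*); rewrite rmorph_nat.
have := Re_le_cmod (z ^+ J.+1 * (1 - z)^*); rewrite cmodM cmodJ cmodX => H.
have H2 : cmod z ^+ J.+1 <= r ^+ J.+1 by rewrite lerXn2r ?nnegrE//; lra.
have H3 : cmod z ^+ J.+1 * cmod (1 - z) <= r ^+ J.+1 * cmod (1 - z).
  by rewrite ler_wpM2r// ltW.
have : 2 * r ^+ J.+1 * cmod (1 - z) <= cmod (1 - z) ^+ 2 * tau.
  have t0 : 0 <= tau.
    rewrite -(@pmulr_lge0 _ (1 - r)) ?subr_gt0//; apply: le_trans tauP.
    by rewrite mulr_ge0 ?exprn_ge0//; apply: le_trans zr.
  apply: (@le_trans _ _ (tau * (1 - r) * cmod (1 - z))); first by rewrite ler_wpM2r// ltW.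
  by rewrite expr2 -mulrA mulrC !ler_wpM2r// ltW.
lra.
Qed.

Lemma normr_sin_le (x : R) : `|sin x| <= `|x|.
Proof.
wlog x0 : x / 0 <= x.
  move=> H; case: (leP 0 x) => [/H//|x0].
  by rewrite -normrN -sinN -(normrN x) H// oppr_ge0 ltW.
have [c _] : exists2 c, c \in `[0, x]%R & sin x - sin 0 = cos c * (x - 0).
  apply: MVT_segment => //.
  by apply: continuous_subspaceT; exact: continuous_sin.
by rewrite sin0 !subr0 => ->; rewrite normrM ler_piMl// cos_max.
Qed.

Lemma cmod_expiB (s t : R) : cmod (expi 1 s - expi 1 t) <= `|s - t|.
Proof.
rewrite -(@ler_pXn2r _ 2) ?nnegrE ?cmod_ge0//.
have -> : cmod (expi 1 s - expi 1 t) ^+ 2 = 4 * sin ((s - t) / 2) ^+ 2.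
  rewrite sqr_cmod /= !mul1r.
  have -> : 4 * sin ((s - t) / 2) ^+ 2 = 2 - 2 * cos (s - t).
    have {2}-> : s - t = ((s - t) / 2) *+ 2 by rewrite mulr2n; lra.
    by rewrite cos_mulr2n cos2sin2; lra.
  rewrite cosB; have := cos2Dsin2 s; have := cos2Dsin2 t; lra.
have -> : `|s - t| ^+ 2 = 4 * `|(s - t) / 2| ^+ 2.
  by rewrite normrM exprMn (ger0_norm (_ : 0 <= 2^-1)) ?invr_ge0//; lra.
rewrite ler_pM2l// -(real_normK (num_real (sin _))) lerXn2r ?nnegrE//.
exact: normr_sin_le.
Qed.

Lemma polar z : exists2 t : R, 0 <= t < 2 * pi & z = (cmod z)%:C * expi 1 t.
Proof.
have pi0 := pi_gt0 R.
have [z0|z0] := eqVneq (cmod z) 0.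
  exists 0; first by rewrite lexx mulr_gt0.
  have /eqP := sqr_cmod z; rewrite z0 mul0r expr0n/= eq_sym paddr_eq0 ?sqr_ge0//.
  by rewrite !sqrf_eq0 => /andP[a b]; apply/eqP; rewrite eq_complex /= a b.
have zp : 0 < cmod z by rewrite lt_neqAle eq_sym z0 cmod_ge0.
pose x := complex.Re z / cmod z; pose y := complex.Im z / cmod z.
have xy : x ^+ 2 + y ^+ 2 = 1.
  by rewrite !expr_div_n -mulrDl -sqr_cmod divff// sqrf_eq0.
have x1 : -1 <= x <= 1 by nra.
have zE (t : R) : cos t = x -> sin t = y -> z = (cmod z)%:C * expi 1 t.
  move=> tx ty; apply/eqP; rewrite eq_complex ReZ ImZ /= !mul1r tx ty.
  by rewrite !(mulrC (cmod z)) !divfK ?eqxx.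
have acx : cos (acos x) = x by rewrite acosK// in_itv.
have sax : sin (acos x) = `|y|.
  by rewrite sin_acos// (_ : 1 - x ^+ 2 = y ^+ 2) ?sqrtr_sqr//; lra.
have a0 := acos_ge0 x1; have api := acos_lepi x1.
case: (leP 0 y) => y0.
  exists (acos x); first by rewrite a0/=; lra.
  by apply: zE; rewrite ?acx ?sax ?ger0_norm.
exists (2 * pi - acos x); last first.
  have -> : 2 * pi - acos x = - acos x + pi *+ 2 by rewrite mulr2n; lra.
  by apply: zE; rewrite ?cosD2pi ?sinD2pi ?cosN ?sinN ?acx// sax ltr0_norm// opprK.
have an0 : acos x != 0.
  by apply/eqP => ax; move: sax; rewrite ax sin0 => /esym/eqP; rewrite normr_eq0 lt_eqF.
have : 0 < acos x by rewrite lt_neqAle eq_sym an0.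
lra.
Qed.

End majorants.

(** * Cones over a set of large measure *)

Section two_constants.
Context {R : realType}.
Implicit Types (z w : R[i]) (E : set R).

(** The arcs are half-open, so they are disjoint, and arc j contains its left endpoint
    [unity_pt N j], where the kernel attached to it in [gap_poly] is centred. *)
Definition gap E (N j : nat) : bool :=
  `[< forall t, E t -> ~ (2 * pi * j%:R / N%:R <= t < 2 * pi * j.+1%:R / N%:R) >].

Definition gap_count E (N : nat) : nat := (\sum_(0 <= j < N | gap E N j) 1)%N.

(* approximates the Poisson integral of the union of the arcs missing E *)
Definition gap_poly E (N J : nat) : {poly R[i]} :=
  ((N%:R : R)^-1)%:C%:P *
  \sum_(0 <= j < N | gap E N j) (herglotz J \Po ((unity_pt N j)^*%:P * 'X)).

Lemma gap_polyE E N J z : (gap_poly E N J).[z] = ((N%:R : R)^-1)%:C *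
  \sum_(0 <= j < N | gap E N j) (herglotz J).[(unity_pt N j)^* * z].
Proof.
rewrite hornerM hornerC horner_sum; congr (_ * _).
by apply: eq_bigr => j _; rewrite horner_comp hornerM hornerC hornerX.
Qed.

(** Each kernel equals 1 at the origin, so the value there is the proportion of gaps; this is what
    makes the loss at the origin small. *)
Lemma gap_poly0 E N J : (gap_poly E N J).[0] = ((gap_count E N)%:R / N%:R)%:C.
Proof.
rewrite gap_polyE mulrC rmorphM /= rmorph_nat; congr (_ * _).
rewrite /gap_count natr_sum; apply: eq_bigr => j _.
rewrite mulr0 /herglotz hornerD hornerZ horner_sum hornerC big1 ?mulr0 ?addr0// => k _.
by rewrite hornerXn exprS mul0r.
Qed.

(** Supplies W + 1 consecutive indices within W of m without wrapping around modulo N: upwards from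
    m in the first half of the circle, downwards in the second. *)
Lemma index_window (m W N : nat) : (m < N)%N -> (4 * W <= N)%N -> (4 <= N)%N ->
  exists2 k, (k + W < N)%N & forall j, (k <= j < k + W.+1)%N ->
    (j <= m + W)%N /\ (m <= j + W)%N.
Proof.
move=> mN WN N4; have [mN2|mN2] := leqP (2 * m) N.
  by exists m; [lia|move=> j; lia].
by exists (m - W)%N; [lia|move=> j; lia].
Qed.

Implicit Types (N J : nat) (tau : R).

Lemma herglotz_unity_ge N J tau z j : (0 < N)%N ->
  2 * (1 - N%:R^-1) ^+ J.+1 <= tau * N%:R^-1 -> cmod z <= 1 - N%:R^-1 ->
  (1 - cmod z ^+ 2) / cmod (z - unity_pt N j) ^+ 2 - tau <=
  complex.Re (herglotz J).[(unity_pt N j)^* * z].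
Proof.
move=> N0 tauP zr; set u := unity_pt N j.
have r1 : 1 - N%:R^-1 < 1 :> R by rewrite gtrBl invr_gt0 ltr0n.
have cu : cmod u^* = 1 by rewrite cmodJ cmod_unity_pt.
have := @herglotz_ge _ J (u^* * z) _ tau; rewrite cmodM cu mul1r => /(_ _ zr r1).
rewrite subKr => /(_ tauP).
have -> // : cmod (1 - u^* * z) = cmod (z - u).
rewrite cmodB -[RHS]mul1r -cu -cmodM mulrBr (mulrC _ u) mulcJ.
by rewrite cmod_unity_pt expr1n.
Qed.

Lemma herglotz_terms_ge0 N J tau z j : (0 < N)%N ->
  2 * (1 - N%:R^-1) ^+ J.+1 <= tau * N%:R^-1 -> cmod z <= 1 - N%:R^-1 ->
  0 <= complex.Re (herglotz J).[(unity_pt N j)^* * z] + tau.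
Proof.
move=> N0 tauP zr.
rewrite -lerBlDr sub0r (le_trans _ (herglotz_unity_ge j N0 tauP zr))// lerDr.
rewrite divr_ge0 ?sqr_ge0// subr_ge0 exprn_ile1 ?cmod_ge0// (le_trans zr)//.
Qed.

Lemma Re_gap_poly E N J z : complex.Re (gap_poly E N J).[z] =
  N%:R^-1 * \sum_(0 <= j < N | gap E N j)
     complex.Re (herglotz J).[(unity_pt N j)^* * z].
Proof. by rewrite gap_polyE ReZ Re_sum. Qed.

Lemma gap_count_le E N : (gap_count E N <= N)%N.
Proof.
rewrite /gap_count big_mkcond /= -[leqRHS]muln1 -[X in (_ <= X * _)%N]subn0.
by rewrite -sum_nat_const_nat leq_sum// => j _; case: gap.
Qed.

(** Adding tau makes every term nonnegative despite the truncation, so that terms can be discarded;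
    after division by N the correction is at most tau. *)
Lemma sum_gap E N J tau z : \sum_(0 <= j < N | gap E N j)
     complex.Re (herglotz J).[(unity_pt N j)^* * z] =
  \sum_(0 <= j < N | gap E N j)
     (complex.Re (herglotz J).[(unity_pt N j)^* * z] + tau) - tau * (gap_count E N)%:R.
Proof.
rewrite big_split /=.
suff -> : tau * (gap_count E N)%:R = \sum_(0 <= j < N | gap E N j) tau by rewrite addrK.
by rewrite /gap_count natr_sum mulr_sumr; apply: eq_bigr => j _; rewrite mulr1.
Qed.

Lemma tau_ge0 N J tau : (0 < N)%N -> 2 * (1 - N%:R^-1) ^+ J.+1 <= tau * N%:R^-1 ->
  0 <= tau.
Proof.
move=> N0 tauP; rewrite -(@pmulr_lge0 _ (N%:R^-1)) ?invr_gt0 ?ltr0n//.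
apply: le_trans tauP; rewrite mulr_ge0 ?exprn_ge0// subr_ge0 invf_le1 ?ltr0n//.
by rewrite ler1n.
Qed.

Lemma Re_gap_poly_ge E N J tau z : (0 < N)%N ->
  2 * (1 - N%:R^-1) ^+ J.+1 <= tau * N%:R^-1 -> cmod z <= 1 - N%:R^-1 ->
  - tau <= complex.Re (gap_poly E N J).[z].
Proof.
move=> N0 tauP zr; have t0 := tau_ge0 N0 tauP.
rewrite Re_gap_poly (sum_gap _ _ _ tau) mulrBr.
apply: (@le_trans _ _ (- (N%:R^-1 * (tau * (gap_count E N)%:R)))).
  rewrite lerN2 mulrC ler_pdivrMr ?ltr0n// ler_wpM2l// ler_nat.
  exact: gap_count_le.
rewrite lerDr mulr_ge0 ?invr_ge0 ?ler0n//.
by apply: sumr_ge0 => j _; exact: herglotz_terms_ge0.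
Qed.

(** Source of the aperture 11. With s = 1 - |z| >= 1/N, the angles differ by at most W + 1 <= (5/4)
    s N arcs of length 2 pi / N, that is by (5/2) pi s < 10 s because pi < 4; the radial distance
    adds s. *)
Lemma arc_near N z (t theta : R) (m j W : nat) : (0 < N)%N ->
  z = (cmod z)%:C * expi 1 theta -> cmod z <= 1 - N%:R^-1 ->
  m%:R <= theta * N%:R / (2 * pi) < m.+1%:R ->
  W%:R <= (1 - cmod z) * N%:R / 4 ->
  (j <= m + W)%N -> (m <= j + W)%N ->
  2 * pi * j%:R / N%:R <= t < 2 * pi * j.+1%:R / N%:R ->
  cmod (z - expi 1 t) <= 11 * (1 - cmod z).
Proof.
rewrite -(ltr0n R) => N0 zE zr /andP[m1 m2] Ws jm mj /andP[t1 t2].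
set s := 1 - cmod z in Ws *.
have pi0 : 0 < pi :> R := pi_gt0 R; have pi4 : pi < 4 :> R by have := pihalf_lt2 R; lra.
have sN : 1 <= s * N%:R.
  by rewrite -ler_pdivrMr// mul1r /s; clear -zr; lra.
have s0 : 0 < s by rewrite -(pmulr_lgt0 _ N0); apply: lt_le_trans sN.
pose v := t * N%:R / (2 * pi); pose u := theta * N%:R / (2 * pi).
have v1 : j%:R <= v by rewrite ler_pdivlMr ?mulr_gt0// mulrC -ler_pdivrMr.
have v2 : v < j.+1%:R by rewrite ltr_pdivrMr ?mulr_gt0// [ltRHS]mulrC -ltr_pdivlMr.
have uv : `|v - u| <= 5 / 4 * (s * N%:R).
  have jm' : j%:R <= m%:R + W%:R :> R by rewrite -natrD ler_nat.
  have mj' : m%:R <= j%:R + W%:R :> R by rewrite -natrD ler_nat.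
  have j1 : j.+1%:R = j%:R + 1 :> R by rewrite natr1.
  have m1_ : m.+1%:R = m%:R + 1 :> R by rewrite natr1.
  by rewrite ler_norml -/u in m1 m2 *; lra.
have ts : `|t - theta| <= 10 * s.
  have -> : t - theta = (v - u) * (2 * pi / N%:R).
    have fld (p n x y : R) : p != 0 -> n != 0 ->
        x - y = (x * n / (2 * p) - y * n / (2 * p)) * (2 * p / n).
      by move=> p0 n0; field; rewrite p0 n0.
    by apply: fld; rewrite gt_eqF.
  rewrite normrM [X in _ * X]gtr0_norm ?divr_gt0 ?mulr_gt0//.
  apply: (@le_trans _ _ (5 / 4 * (s * N%:R) * (2 * pi / N%:R))).
    by rewrite ler_wpM2r// divr_ge0 ?mulr_ge0 ?ltW.
  have -> : 5 / 4 * (s * N%:R) * (2 * pi / N%:R) = 5 / 2 * s * pi.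
    by field; rewrite gt_eqF.
  nra.
rewrite (le_trans (cmodBT (expi 1 theta) _ _))//.
have -> : 11 * s = s + 10 * s by lra.
apply: lerD; last by rewrite (le_trans (cmod_expiB _ _))// distrC.
rewrite zE -[X in _ - X]mul1r -mulrBl cmodM cmod_expi mulr1.
rewrite -(rmorph1 (real_complex R)) -rmorphB cmod_real distrC ger0_norm// -/s; lra.
Qed.

(* If z misses all the cones, then the about (1 - |z|) N / 4 arcs next to z / |z|
   are gaps, and each contributes about 1 / (121 (1 - |z|)). *)
Lemma gap_poly_cone E N J tau z : (4 <= N)%N ->
  2 * (1 - N%:R^-1) ^+ J.+1 <= tau * N%:R^-1 -> tau <= 1 / 20000 ->
  cmod z <= 1 - N%:R^-1 ->
  complex.Re (gap_poly E N J).[z] <= 1 / 500 ->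
  exists2 t, E t & cmod (z - expi 1 t) <= 11 * (1 - cmod z).
Proof.
move=> N4 tauP tau_le zr; have N0n : (0 < N)%N by apply: leq_trans N4.
have N0 : 0 < N%:R :> R by rewrite ltr0n.
have t0 := tau_ge0 N0n tauP.
apply: contraPP => noE; apply/negP; rewrite -ltNge.
have [theta /andP[th0 th1] zE] := polar z.
set s := 1 - cmod z.
have pi0 : 0 < pi :> R := pi_gt0 R.
have sN : 1 <= s * N%:R.
  by rewrite -ler_pdivrMr// mul1r /s; clear -zr; lra.
have s0 : 0 < s by rewrite -(pmulr_lgt0 _ N0); apply: lt_le_trans sN.
have s1 : s <= 1 by rewrite gerBl cmod_ge0.
pose u := theta * N%:R / (2 * pi).
have u0 : 0 <= u by rewrite divr_ge0 ?mulr_ge0 ?pi_ge0.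
have uN : u < N%:R by rewrite ltr_pdivrMr ?mulr_gt0// mulrC ltr_pM2l.
have sN4 : 0 <= s * N%:R / 4 by clear -sN; lra.
pose m := Num.truncn u; pose W := Num.truncn (s * N%:R / 4).
have /andP[m1 m2] := truncn_itv u0.
have /andP[W1 W2] := truncn_itv sN4.
rewrite -/m in m1 m2; rewrite -/W in W1 W2.
have mN : (m < N)%N by rewrite -(ltr_nat R); apply: le_lt_trans uN.
have W4N : (4 * W <= N)%N.
  rewrite -(ler_nat R) natrM; have : s * N%:R <= N%:R by rewrite ler_piMl// ltW.
  by clear -W1; lra.
have [k0 k0N k0W] := index_window mN W4N N4.
have closeP j t : (k0 <= j < k0 + W.+1)%N ->
    2 * pi * j%:R / N%:R <= t < 2 * pi * j.+1%:R / N%:R ->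
    cmod (z - expi 1 t) <= 11 * s.
  by move=> /k0W[jm mj]; apply: (arc_near N0n zE zr _ W1 jm mj); rewrite m1 m2.
have gapj j : (k0 <= j < k0 + W.+1)%N -> gap E N j.
  by move=> jo; apply/asboolP => t Et tj; apply: noE; exists t => //; exact: closeP tj.
rewrite Re_gap_poly (sum_gap _ _ _ tau) mulrBr.
have tN : N%:R^-1 * (tau * (gap_count E N)%:R) <= tau.
  by rewrite mulrC ler_pdivrMr// ler_wpM2l// ler_nat gap_count_le.
(* The window has more than s N / 4 indices, each contributing at least 1 / (121 s), and 4 * 121 =
   484. The threshold 1/500 is chosen below 1/484 - 1/20000. *)
suff : N%:R / 484 <= \sum_(0 <= j < N | gap E N j)
    (complex.Re (herglotz J).[(unity_pt N j)^* * z] + tau).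
  move=> /(ler_wpM2l (ltW (_ : 0 < N%:R^-1))); rewrite invr_gt0 => /(_ N0).
  rewrite mulrA mulVf ?gt_eqF// => H; clear -H tN tau_le; lra.
rewrite (@big_cat_nat _ _ _ k0)//=; last by rewrite ltnW// (leq_ltn_trans (leq_addr W k0)).
rewrite -[leLHS]add0r lerD//.
  by apply: sumr_ge0 => j _; exact: herglotz_terms_ge0.
rewrite (@big_cat_nat _ _ _ (k0 + W.+1))//=; [|exact: leq_addr|by rewrite addnS].
rewrite -[leLHS]addr0 lerD//; last first.
  by apply: sumr_ge0 => j _; exact: herglotz_terms_ge0.
apply: (@le_trans _ _ (\sum_(k0 <= j < k0 + W.+1) (121 * s)^-1)).
  rewrite sumr_const_nat addKn -[leRHS]mulr_natl ler_pdivlMr ?mulr_gt0//.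
  by rewrite (_ : _ * (121 * s) = s * N%:R / 4) ?(ltW W2)//; clear; field.
rewrite [leRHS]big_mkcond /= !big_nat; apply: ler_sum => j jo; rewrite gapj//.
have zu : cmod (z - unity_pt N j) <= 11 * s.
  apply: (closeP j) => //; rewrite lexx /= ltr_pM2r ?invr_gt0//.
  by rewrite ltr_pM2l ?mulr_gt0// ltr_nat.
rewrite -lerBlDr (le_trans _ (herglotz_unity_ge j N0n tauP zr))// lerD2r.
have zu0 : 0 < cmod (z - unity_pt N j).
  have := cmodBD z (z - unity_pt N j); rewrite opprB addrC subrK cmod_unity_pt.
  by rewrite /s in s0; clear -s0; lra.
rewrite ler_pdivlMr ?exprn_gt0//.
(* The numerator of the Poisson kernel is 1 - |z|^2 = s (1 + |z|) >= s, so the kernel is at least s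
   / (11 s)^2. *)
apply: (@le_trans _ _ ((121 * s)^-1 * (11 * s) ^+ 2)).
  rewrite ler_wpM2l ?invr_ge0 ?mulr_ge0 ?(ltW s0)// lerXn2r ?nnegrE ?(ltW zu0)//.
  by rewrite mulr_ge0 ?(ltW s0).
have -> : (121 * s)^-1 * (11 * s) ^+ 2 = s by field; rewrite gt_eqF.
rewrite /s in s0 s1 *; have := cmod_ge0 z; clear -s1 s0; nra.
Qed.

End two_constants.

(** * The two-constants estimate *)

Section two_constants.
Context {R : realType}.
Implicit Types (z w : R[i]) (E : set R).

Lemma exp_small (x e : R) : 0 <= x < 1 -> 0 < e -> exists n, x ^+ n <= e.
Proof.
move=> /andP[x0 x1] e0; have : `|x| < 1 by rewrite ger0_norm.
move=> /cvg_expr /cvgrPdist_le /(_ e e0) [n _ /(_ n (leqnn n))] /=.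
by rewrite sub0r normrN normrX ger0_norm // => ?; exists n.
Qed.

Lemma nat_ge (x : R) : exists n : nat, x <= n%:R.
Proof.
by exists (Num.truncn `|x|).+1; rewrite (le_trans (ler_norm _))// ltW// truncnS_gt.
Qed.

Lemma onem_ge_expR (x : R) : 0 <= x <= 1 / 2 -> expR (- (2 * x)) <= 1 - x.
Proof.
move=> /andP[x0 x1]; rewrite expRN -[leLHS]mul1r ler_pdivrMr ?expR_gt0//.
apply: (@le_trans _ _ ((1 - x) * (1 + 2 * x))); first by nra.
by rewrite ler_wpM2l ?expR_ge1Dx//; lra.
Qed.

Lemma cmod_onem_le z : cmod (1 - z) <= expR (- complex.Re z + cmod z ^+ 2 / 2).
Proof.
rewrite -(@ler_pXn2r _ 2) ?nnegrE ?cmod_ge0 ?expR_ge0//.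
rewrite -expRM_natl.
have -> : cmod (1 - z) ^+ 2 = 1 + (- 2 * complex.Re z + cmod z ^+ 2).
  by rewrite !sqr_cmod; case: z => a b /=; ring.
by rewrite (le_trans (expR_ge1Dx _))// ler_expR; lra.
Qed.

(** The exponent 3/20 = 1/10 + 1/20 collects the errors of [two_constants]: 1/10 from truncating the
    kernels, 1/20 from replacing exp(-Q) by a power. *)
Lemma expR_le2 : expR (3 / 20) <= 2 :> R.
Proof.
have := expR_ge1Dx (- (3 / 20) : R); rewrite expRN.
have := expR_gt0 (3 / 20 : R); set e := expR _ => e0.
by rewrite -(ler_pM2r e0) mulVf ?gt_eqF//; lra.
Qed.


(** The maximum principle is applied to (P - a) exp(-q - A w), with w the gap polynomial. On |z| = r
    the point is close to E and |P - a| is about beta. On Re w = 1/500 the growth of P is at most a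
    constant times exp(Re q), which the factor exp(-q) cancels, leaving exp(-A/500). At the origin P
    vanishes, so the modulus is about a exp(-u - A w(0)). *)
Lemma two_constants (P q : {poly R[i]}) E (a beta B u eps A : R) :
  0 < a -> 0 < beta -> 0 <= B -> 0 <= A -> eps <= 1 / 500 ->
  P.[0] = 0 ->
  (forall t, E t -> cmod (P.[expi 1 t] - a%:C) <= beta) ->
  (forall t z, E t -> cmod z < 1 -> cmod (z - expi 1 t) <= 11 * (1 - cmod z) ->
     cmod P.[z] <= B + complex.Re q.[z]) ->
  (forall z, cmod z <= 1 -> 0 <= complex.Re q.[z]) -> q.[0] = u%:C ->
  (forall N, (0 < N)%N -> (gap_count E N)%:R <= eps * N%:R) ->
  a * expR (- (2 * (u + A * eps))) <=
    Num.max (4 * beta) (4 * ((B + a + 1) * expR (- (A / 500)))).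
Proof.
move=> a0 beta0 B0 A0 eps_le P0 PE Pcone q_ge0 q0 gapE.
have u_ge0 : 0 <= u by have := q_ge0 0; rewrite q0 /= cmod0 => /(_ ler01).
have [Lp Lp0 LpP] := poly_lipschitz P (@ler01 R).
have [N0 N0P] := nat_ge (11 * Lp / beta).
(* A point with |z| = 1 - 1/N is within 11/N of a vertex in E, so by the Lipschitz bound P changes
   by at most beta between them. *)
pose N := (N0 + 4)%N.
have N4 : (4 <= N)%N by rewrite leq_addl.
have Npos : (0 < N)%N by exact: leq_trans N4.
have NR : 0 < N%:R :> R by rewrite ltr0n.
have LpN : Lp * (11 * N%:R^-1) <= beta.
  rewrite mulrA ler_pdivrMr// -ler_pdivrMl// mulrC (mulrC Lp) (le_trans N0P)//.
  by rewrite ler_nat leq_addr.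
set r : R := 1 - N%:R^-1.
have r01 : 0 <= r < 1.
  rewrite subr_ge0 invf_le1// ler1n Npos gtrBl invr_gt0 NR//.
have rp : 0 < r by rewrite subr_gt0 invf_lt1// ltr1n (leq_trans _ N4).
(* The first bound is the one required by [gap_poly_cone]; the second gives A tau <= 1/10 in the
   exponent. *)
pose tau : R := Num.min (1 / 20000) (1 / (10 * (A + 1))).
have A1 : 0 < 10 * (A + 1) by clear -A0; lra.
have tau0 : 0 < tau.
  by rewrite lt_min; apply/andP; split; [clear; lra|rewrite divr_gt0].
have tN0 : 0 < tau * N%:R^-1 / 2 by rewrite !divr_gt0.
have [J' J'P] := exp_small r01 tN0.
have [J JP] : exists J, 2 * r ^+ J.+1 <= tau * N%:R^-1.
  exists J'; rewrite mulrC -ler_pdivlMr// (le_trans _ J'P)// exprS.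
  by case/andP: r01 => rge0 rl1; rewrite ler_piMl ?exprn_ge0// ltW.
have tau1 : tau <= 1 / 20000 by rewrite ge_min lexx.
have tauA : A * tau <= 1 / 10.
  apply: (@le_trans _ _ (A * (1 / (10 * (A + 1))))).
    by rewrite ler_wpM2l// ge_min lexx orbT.
  by rewrite mulrA mulr1 ler_pdivrMr//; clear -A0; lra.
pose w := gap_poly E N J.
pose Q := q + A%:C%:P * w.
have [D D0 DQ] := poly_bounded Q (@ler01 R).
(* L >= 10 D^2 makes the second-order error |Q|^2 / (2 L) at most 1/20; L >= 2 (u + A) makes
   [onem_ge_expR] applicable at the origin. *)
have [L0 L0P] := nat_ge (10 * D ^+ 2 + 2 * (u + A)).
pose L := L0.+1.
have LR : 10 * D ^+ 2 + 2 * (u + A) <= L%:R.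
  by rewrite (le_trans L0P)// ler_nat.
have L0R : 0 < L%:R :> R by rewrite ltr0n.
(* (1 - Q / L)^L stands for exp (- Q), so that T is still a polynomial *)
pose T := (P - a%:C%:P) * (1 - (L%:R^-1)%:C%:P * Q) ^+ L.
have TE z : T.[z] = (P.[z] - a%:C) * (1 - (L%:R^-1)%:C * Q.[z]) ^+ L.
  by rewrite /T hornerM horner_exp !(hornerD, hornerN, hornerM, hornerC).
have TB z : cmod z <= 1 ->
    cmod T.[z] <= cmod (P.[z] - a%:C) * expR (- complex.Re Q.[z] + 1 / 20).
  move=> z1; rewrite TE cmodM ler_wpM2l ?cmod_ge0// cmodX.
  apply: (le_trans (lerXn2r L _ _ (cmod_onem_le _))); rewrite ?nnegrE ?cmod_ge0 ?expR_ge0//.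
  rewrite -expRM_natl ler_expR ReZ cmodM ger0_cmod ?invr_ge0//.
  have DQz : cmod Q.[z] ^+ 2 <= D ^+ 2 by rewrite lerXn2r ?nnegrE ?cmod_ge0 ?DQ.
  have -> : L%:R * (- (L%:R^-1 * complex.Re Q.[z]) + (L%:R^-1 * cmod Q.[z]) ^+ 2 / 2) =
      - complex.Re Q.[z] + cmod Q.[z] ^+ 2 / 2 / L%:R.
    by clear -L0R; field; rewrite gt_eqF.
  rewrite lerD2l ler_pdivrMr//.
  have : 0 <= u + A by rewrite addr_ge0.
  clear -DQz LR; lra.
have r_le1 z : cmod z <= r -> cmod z <= 1.
  by move=> /le_trans; apply; rewrite ltW//; case/andP: r01.
have QE z : complex.Re Q.[z] = complex.Re q.[z] + A * complex.Re w.[z].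
  by rewrite /Q hornerD ReD hornerM hornerC ReZ.
have cone z : cmod z <= r -> complex.Re w.[z] <= 1 / 500 ->
    exists2 t, E t & cmod (z - expi 1 t) <= 11 * (1 - cmod z).
  exact: gap_poly_cone N4 JP tau1.
set C := B + a + 1; have C0 : 0 < C by rewrite ltr_wpDl// addr_ge0 ?(ltW a0).
set M := Num.max _ _.
have M0 : 0 <= M by rewrite le_max mulr_ge0// ltW.
have key z : cmod z <= r -> complex.Re w.[z] <= 1 / 500 ->
    cmod z = r \/ complex.Re w.[z] = 1 / 500 -> cmod T.[z] <= M.
  move=> zr zw bd; have z1 := r_le1 _ zr; rewrite (le_trans (TB z z1))//.
  have [t Et zt] := cone z zr zw; rewrite /M le_max; apply/orP.
  case: bd => [zr1|zw1]; [left|right].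
    have Paz : cmod (P.[z] - a%:C) <= 2 * beta.
      rewrite (le_trans (cmodBT P.[expi 1 t] _ _))// mulr_natl mulr2n lerD ?PE//.
      rewrite (le_trans (LpP _ _ _ _))// ?cmod_expi//.
      rewrite (le_trans _ LpN)// ler_wpM2l//.
      by rewrite (le_trans zt)// zr1 /r subKr.
    have -> : 4 * beta = 2 * beta * 2 by rewrite mulrAC -natrM.
    rewrite ler_pM ?cmod_ge0 ?expR_ge0// (le_trans _ expR_le2)// ler_expR QE.
    have := q_ge0 z z1; have wz := Re_gap_poly_ge E Npos JP zr.
    rewrite -/w in wz => qz.
    have : - (1 / 10) <= A * complex.Re w.[z].
      apply: (@le_trans _ _ (A * - tau)); last by rewrite ler_wpM2l.
      by rewrite mulrN lerN2.
    clear -qz; lra.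
  have zlt1 : cmod z < 1 by apply: le_lt_trans zr _; case/andP: r01.
  have U0 := q_ge0 z z1; set U := complex.Re q.[z] in U0.
  (* The additive bound on P becomes multiplicative through 1 + U <= exp U, in the form that the
     weight exp(-U) cancels. *)
  have Paz : cmod (P.[z] - a%:C) <= C * expR U.
    apply: (@le_trans _ _ (C * (1 + U))); last by rewrite ler_pM2l// expR_ge1Dx.
    rewrite (le_trans (cmodBD _ _))// ger0_cmod ?(ltW a0)//.
    have := Pcone t z Et zlt1 zt; rewrite -/U /C; clear -U0 B0 a0; nra.
  apply: (@le_trans _ _ (C * expR U * expR (- complex.Re Q.[z] + 1 / 20))).
    by rewrite ler_wpM2r ?expR_ge0.
  rewrite QE zw1 -/U -mulrA -expRD [leRHS]mulrCA ler_pM2l//.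
  have -> : U + (- (U + A * (1 / 500)) + 1 / 20) = 1 / 20 - A / 500 by clear; lra.
  rewrite expRD ler_wpM2r ?expR_ge0// (@le_trans _ _ 2)//; last by rewrite ler_nat.
  by rewrite (le_trans _ expR_le2)// ler_expR; clear; lra.
have w0 : w.[0] = ((gap_count E N)%:R / N%:R)%:C by exact: gap_poly0.
set v : R := (gap_count E N)%:R / N%:R in w0.
have v0 : 0 <= v by rewrite divr_ge0.
have veps : v <= eps by rewrite ler_pdivrMr// gapE.
(* The origin belongs to the region because the proportion of gaps is at most eps <= 1/500. *)
have := max_principle rp M0 key (z := 0).
rewrite cmod0 w0 /= (ltW rp) (le_trans veps eps_le) => /(_ isT isT).
apply: le_trans; rewrite TE P0 sub0r cmodM cmodN ger0_cmod ?(ltW a0)// cmodX.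
rewrite ler_pM2l//.
have -> : 1 - (L%:R^-1)%:C * Q.[0] = (1 - (u + A * v) / L%:R)%:C.
  rewrite /Q hornerD hornerM hornerC q0 w0.
  by rewrite -!(rmorphM, rmorphD) /= -(rmorph1 (real_complex R)) -rmorphB /= (mulrC L%:R^-1).
have Av : A * v <= A.
  rewrite ler_piMr//; apply: le_trans veps _; apply: le_trans eps_le _.
  by clear; lra.
have Av0 : 0 <= A * v by rewrite mulr_ge0.
have x01 : 0 <= (u + A * v) / L%:R <= 1 / 2.
  rewrite divr_ge0 ?addr_ge0//= ler_pdivrMr//.
  have := sqr_ge0 D; clear -LR Av; lra.
have := onem_ge_expR x01; set x := _ / L%:R in x01 * => ex.
have x1 : 0 <= 1 - x by rewrite (le_trans _ ex)// expR_ge0.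
rewrite ger0_cmod//; apply: (@le_trans _ _ (expR (- (2 * x)) ^+ L)).
  rewrite -expRM_natl ler_expR /x.
  have -> : L%:R * - (2 * ((u + A * v) / L%:R)) = - (2 * (u + A * v)).
    by clear -L0R; field; rewrite gt_eqF.
  by rewrite lerN2 ler_pM2l// lerD2l ler_wpM2l.
by rewrite lerXn2r ?nnegrE ?expR_ge0.
Qed.

End two_constants.

(** * Square-integrable functions on the circle *)

Section integrals.
Context {R : realType}.
Notation mu := (@lebesgue_measure R).
Notation I := (@Tset R).
Implicit Types (u v : R -> R) (f g : R -> R[i]).

Definition rint u := mu.-integrable I (EFin \o u).

Lemma pi2_gt0 : 0 < 2 * pi :> R.
Proof. by rewrite mulr_gt0// pi_gt0. Qed.

Lemma measurable_Tset : measurable I.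
Proof. exact: measurable_itv. Qed.
Hint Resolve measurable_Tset : core.

Lemma mu_Tset : mu I = (2 * pi)%:E.
Proof.
by rewrite /Tset lebesgue_measure_itv /= lte_fin pi2_gt0 -EFinB subr0.
Qed.

Lemma mu_Tset_fin : (mu I < +oo)%E.
Proof. by rewrite mu_Tset ltry. Qed.

Lemma rint_bounded u K : measurable_fun I u -> (forall x, I x -> `|u x| <= K) -> rint u.
Proof.
move=> mu_ uK; apply: measurable_bounded_integrable => //; first exact: mu_Tset_fin.
exists K; split; rewrite ?num_real // => M KM x Ix.
by rewrite /= (le_trans (uK _ Ix))// ltW.
Qed.

Lemma rint_le u v : measurable_fun I u -> (forall x, I x -> `|u x| <= v x) ->
  rint v -> rint u.
Proof.
move=> mu_ uv; apply: le_integrable => //; first exact/measurable_EFinP.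
by move=> x Ix; rewrite /= lee_fin (le_trans (uv x Ix))// ler_norm.
Qed.

Lemma rintD u v : rint u -> rint v -> rint (fun x => u x + v x).
Proof. by move=> iu iv; apply: eq_integrable (integrableD _ iu iv). Qed.

Lemma rintZ c u : rint u -> rint (fun x => c * u x).
Proof. by move=> iu; apply: eq_integrable (integrableZl _ c iu). Qed.

Lemma rintB u v : rint u -> rint v -> rint (fun x => u x - v x).
Proof.
move=> iu /(rintZ (-1)) iv; have := rintD iu iv.
by apply: eq_integrable => // x _; rewrite /= mulN1r.
Qed.

Definition cint f : R[i] :=
  Complex (Rintegral mu I (fun t => complex.Re (f t)))
          (Rintegral mu I (fun t => complex.Im (f t))).

Definition cintegrable f :=
  rint (fun t => complex.Re (f t)) /\ rint (fun t => complex.Im (f t)).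

Lemma eq_cint f g : (forall t, I t -> f t = g t) -> cint f = cint g.
Proof.
by move=> fg; congr Complex; apply: eq_Rintegral => t /set_mem It; rewrite fg.
Qed.

Lemma cintegrableD f g : cintegrable f -> cintegrable g ->
  cintegrable (fun t => f t + g t).
Proof.
move=> [fR fI] [gR gI]; split.
  by under eq_fun do rewrite ReD; exact: rintD.
by under eq_fun do rewrite ImD; exact: rintD.
Qed.

Lemma cintD f g : cintegrable f -> cintegrable g ->
  cint (fun t => f t + g t) = cint f + cint g.
Proof.
move=> [fR fI] [gR gI]; rewrite /cint.
under eq_Rintegral do rewrite ReD; under [in X in Complex _ X]eq_Rintegral do rewrite ImD.
by rewrite !RintegralD.
Qed.

Lemma cintegrableZ c f : cintegrable f -> cintegrable (fun t => c * f t).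
Proof.
move=> [fR fI]; split.
  by under eq_fun do rewrite ReM; apply: rintB; exact: rintZ.
by under eq_fun do rewrite ImM; apply: rintD; exact: rintZ.
Qed.

Lemma cintZ c f : cintegrable f -> cint (fun t => c * f t) = c * cint f.
Proof.
move=> [fR fI]; rewrite /cint; apply/eqP; rewrite eq_complex ReM ImM /=.
under eq_Rintegral do rewrite ReM; under [in X in _ && X]eq_Rintegral do rewrite ImM.
rewrite RintegralB ?RintegralD//; try exact: rintZ.
by rewrite !RintegralZl// !eqxx.
Qed.

Lemma cintegrable0 : cintegrable (fun=> 0).
Proof. by split; exact: integrable0. Qed.

Lemma cint0 : cint (fun=> 0) = 0.
Proof. by rewrite /cint !Rintegral_cst// !mul0r. Qed.

Lemma cintegrable_sum (J : Type) (s : seq J) (F : J -> R -> R[i]) :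
  (forall j, cintegrable (F j)) -> cintegrable (fun t => \sum_(j <- s) F j t).
Proof.
move=> iF; elim: s => [|j s IHs].
  by under eq_fun do rewrite big_nil; exact: cintegrable0.
by under eq_fun do rewrite big_cons; exact: cintegrableD.
Qed.

Lemma cint_sum (J : Type) (s : seq J) (F : J -> R -> R[i]) :
  (forall j, cintegrable (F j)) ->
  cint (fun t => \sum_(j <- s) F j t) = \sum_(j <- s) cint (F j).
Proof.
move=> iF; elim: s => [|j s IHs].
  by rewrite big_nil -[RHS]cint0; apply: eq_cint => t _; rewrite big_nil.
rewrite big_cons -IHs -cintD//; last exact: cintegrable_sum.
by apply: eq_cint => t _; rewrite big_cons.
Qed.

Lemma fourier_coefE f n : fourier_coef f n =
  ((2 * pi)^-1)%:C * cint (fun t => f t * expi (- n) t).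
Proof.
by apply/eqP; rewrite eq_complex ReZ ImZ !eqxx.
Qed.

Lemma cmeasurableD f g : cmeasurable f -> cmeasurable g ->
  cmeasurable (fun t => f t + g t).
Proof.
move=> [fR fI] [gR gI]; split.
  by under eq_fun do rewrite ReD; exact: measurable_funD.
by under eq_fun do rewrite ImD; exact: measurable_funD.
Qed.

Lemma cmeasurableM f g : cmeasurable f -> cmeasurable g ->
  cmeasurable (fun t => f t * g t).
Proof.
move=> [fR fI] [gR gI]; split.
  by under eq_fun do rewrite ReM; apply: measurable_funB; exact: measurable_funM.
by under eq_fun do rewrite ImM; apply: measurable_funD; exact: measurable_funM.
Qed.

Lemma cmeasurable_cst c : cmeasurable (fun _ : R => c).
Proof. by split; exact: measurable_cst. Qed.

Lemma cmeasurableJ f : cmeasurable f -> cmeasurable (fun t => (f t)^*).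
Proof.
move=> [fR fI]; split.
  by rewrite (_ : (fun t => _) = (fun t => complex.Re (f t)))//; apply/funext => t; case: (f t).
rewrite (_ : (fun t => _) = (fun t => - complex.Im (f t))); first exact: measurable_funN.
by apply/funext => t; case: (f t).
Qed.

Lemma measurable_sqr_cmod f : cmeasurable f -> measurable_fun I (fun t => cmod (f t) ^+ 2).
Proof.
move=> [fR fI]; under eq_fun do rewrite sqr_cmod.
by apply: measurable_funD; exact: measurable_funX.
Qed.

Lemma measurable_cmod f : cmeasurable f -> measurable_fun I (fun t => cmod (f t)).
Proof.
move=> mf; rewrite (_ : (fun t => _) = Num.sqrt \o (fun t => cmod (f t) ^+ 2)).
  apply: measurableT_comp; last exact: measurable_sqr_cmod.
  by apply: continuous_measurable_fun; exact: sqrt_continuous.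
by apply/funext => t /=; rewrite sqrtr_sqr ger0_norm// cmod_ge0.
Qed.

(** Not divided by 2 pi, hence the factor 2 pi in [normsq_trig]. *)
Definition normsq f : R := Rintegral mu I (fun t => cmod (f t) ^+ 2).

Lemma L2T_rint f : L2T f -> rint (fun t => cmod (f t) ^+ 2).
Proof. by case. Qed.

Lemma L2T_bounded f K : cmeasurable f -> (forall t, I t -> cmod (f t) <= K) -> L2T f.
Proof.
move=> mf fK; split=> //; apply: (@rint_bounded _ (K ^+ 2)).
  exact: measurable_sqr_cmod.
move=> x Ix; rewrite ger0_norm ?sqr_ge0// lerXn2r ?nnegrE ?cmod_ge0 ?fK//.
exact: le_trans (cmod_ge0 _) (fK x Ix).
Qed.

Lemma L2T_cst c : L2T (fun _ : R => c).
Proof. by apply: (@L2T_bounded _ (cmod c)) => //; exact: cmeasurable_cst. Qed.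

Lemma sqr_cmodD_le (z w : R[i]) : cmod (z + w) ^+ 2 <= 2 * cmod z ^+ 2 + 2 * cmod w ^+ 2.
Proof.
rewrite !sqr_cmod; case: z w => a b [c d] /=; have := sqr_ge0 (a - c).
have := sqr_ge0 (b - d); nra.
Qed.

Lemma L2TD f g : L2T f -> L2T g -> L2T (fun t => f t + g t).
Proof.
move=> [mf if_] [mg ig]; split; first exact: cmeasurableD.
apply: (@rint_le _ (fun t => 2 * cmod (f t) ^+ 2 + 2 * cmod (g t) ^+ 2)).
- by apply: (@measurable_sqr_cmod (fun t => f t + g t)); exact: cmeasurableD.
- by move=> t _; rewrite ger0_norm ?sqr_ge0 ?sqr_cmodD_le.
- by apply: rintD; exact: rintZ.
Qed.

Lemma L2TZ c f : L2T f -> L2T (fun t => c * f t).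
Proof.
move=> [mf if_]; split; first by apply: cmeasurableM => //; exact: cmeasurable_cst.
have := rintZ (cmod c ^+ 2) if_; apply: eq_integrable => // t _.
by rewrite /= cmodM exprMn.
Qed.

Lemma L2TN f : L2T f -> L2T (fun t => - f t).
Proof. by move=> /(L2TZ (-1)); under eq_fun do rewrite mulN1r. Qed.

Lemma L2TB f g : L2T f -> L2T g -> L2T (fun t => f t - g t).
Proof. by move=> Lf /L2TN Lg; exact: L2TD. Qed.

Lemma L2T_sum (J : Type) (s : seq J) (F : J -> R -> R[i]) :
  (forall j, L2T (F j)) -> L2T (fun t => \sum_(j <- s) F j t).
Proof.
move=> iF; elim: s => [|j s IHs].
  by under eq_fun do rewrite big_nil; exact: L2T_cst.
by under eq_fun do rewrite big_cons; exact: L2TD.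
Qed.

Lemma L2T_mulJ f g : L2T f -> L2T g -> cintegrable (fun t => f t * (g t)^*).
Proof.
move=> [mf if_] [mg ig]; have [mR mI] := cmeasurableM mf (cmeasurableJ mg).
have le t : cmod (f t * (g t)^*) <= cmod (f t) ^+ 2 + cmod (g t) ^+ 2.
  rewrite cmodM cmodJ; have := sqr_ge0 (cmod (f t) - cmod (g t)).
  have := sqr_ge0 (cmod (f t)); have := sqr_ge0 (cmod (g t)); nra.
by split; (apply: rint_le (rintD if_ ig) => // t _;
  apply: le_trans (le t); rewrite ?normr_Re_le ?normr_Im_le).
Qed.

Lemma L2T_L1T f : L2T f -> L1T f.
Proof.
move=> [mf if_]; split=> //.
apply: (@rint_le _ (fun t => 1 + cmod (f t) ^+ 2)); first exact: measurable_cmod.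
  move=> t _; rewrite ger0_norm ?cmod_ge0//.
  by have := sqr_ge0 (cmod (f t) - 1); have := cmod_ge0 (f t); nra.
apply: rintD => //; apply: (@rint_bounded _ 1) => [|x _]; first exact: measurable_cst.
by rewrite normr1.
Qed.

Lemma normsq_ge0 f : 0 <= normsq f.
Proof. by apply: Rintegral_ge0 => t _; rewrite sqr_ge0. Qed.

Lemma normsqD_le f g : L2T f -> L2T g ->
  normsq (fun t => f t + g t) <= 2 * normsq f + 2 * normsq g.
Proof.
move=> Lf Lg; have [_ if_] := Lf; have [_ ig] := Lg.
rewrite /normsq -!RintegralZl// -RintegralD//; try exact: rintZ.
apply: le_Rintegral => //; first exact: (L2TD Lf Lg).2.
  by apply: rintD; exact: rintZ.
by move=> t _; exact: sqr_cmodD_le.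
Qed.

End integrals.
#[export] Hint Resolve measurable_Tset : core.

(** * Fourier coefficients *)

Section fourier.
Context {R : realType}.
Notation mu := (@lebesgue_measure R).
Notation I := (@Tset R).
Implicit Types (f g T : R -> R[i]) (n m : int) (b : int -> R[i]) (s : seq int).

Lemma continuous_linear_comp (F : R -> R) (c : R) : continuous F ->
  continuous (fun t => F (c * t)).
Proof.
move=> cF t; apply: continuous_comp; last exact: cF.
by apply: cvgM; [exact: cvg_cst|exact: cvg_id].
Qed.

Lemma cmeasurable_expi n : cmeasurable (@expi R n).
Proof.
by split; apply: measurable_funS (@subsetT _ _) _ => //;
  apply: continuous_measurable_fun; apply: continuous_linear_comp;
  [exact: continuous_cos|exact: continuous_sin].
Qed.

Lemma L2T_expi n : L2T (@expi R n).
Proof.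
by apply: (@L2T_bounded _ _ 1) => [|t _]; [exact: cmeasurable_expi|rewrite cmod_expi].
Qed.

Lemma expi_2pi n : expi n (2 * pi) = 1 :> R[i].
Proof.
have natP (k : nat) : expi k%:Z (2 * pi) = 1 :> R[i].
  rewrite expi_nat (_ : expi 1 _ = 1) ?expr1n//.
  by rewrite /expi !mul1r mulr_natl cos2pi sin2pi.
case: n => k; first exact: natP.
by rewrite NegzE expiN natP rmorph1.
Qed.

Lemma integral_derivative (F f : R -> R) : continuous f ->
  (forall t : R, is_derive t (1 : R) F (f t)) -> F 0 = F (2 * pi) -> Rintegral mu I f = 0.
Proof.
move=> cf dF F0; rewrite /Rintegral /Tset (@continuous_FTC2 _ f F 0 (2 * pi)).
- by rewrite F0 -EFinB subrr.
- exact: pi2_gt0.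
- exact: continuous_subspaceT.
- have cF : continuous F by move=> t; apply/differentiable_continuous/derivable1_diffP.
  split=> [t _||].
  + exact: ex_derive.
  + exact/cvg_at_right_filter/cF.
  + exact/cvg_at_left_filter/cF.
- by move=> t _; rewrite derive1E derive_val.
Qed.

Lemma cint_expi n : cint (@expi R n) = if n == 0 then (2 * pi)%:C else 0.
Proof.
case: eqVneq => [->|n0].
  rewrite (eq_cint (fun t _ => expi0 t)) /cint /= !Rintegral_cst; try exact: measurable_Tset.
  by rewrite mul0r mul1r; congr Complex; exact: (congr1 fine mu_Tset).
have k0 : n%:~R != 0 :> R by rewrite intr_eq0.
have dl (t : R) : is_derive t (1 : R) (fun x : R => n%:~R * x) n%:~R.
  by apply: (is_derive_eq (is_deriveZ n%:~R (is_derive_id t 1))); exact: mulr1.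
have := expi_2pi n; rewrite /expi => -[c1 s0].
apply/eqP; rewrite eq_complex /=; apply/andP; split; apply/eqP.
- apply: (@integral_derivative (fun t => n%:~R^-1 * sin (n%:~R * t))).
  + by apply: continuous_linear_comp; exact: continuous_cos.
  + move=> t; apply: (is_derive_eq (is_deriveZ n%:~R^-1 (is_derive1_comp (is_derive_sin _) (dl t)))).
    by rewrite /GRing.scale /= mulrCA mulVf ?mulr1.
  + by rewrite mulr0 s0 sin0.
- apply: (@integral_derivative (fun t => - n%:~R^-1 * cos (n%:~R * t))).
  + by apply: continuous_linear_comp; exact: continuous_sin.
  + move=> t; apply: (is_derive_eq (is_deriveZ (- n%:~R^-1) (is_derive1_comp (is_derive_cos _) (dl t)))).
    by rewrite /GRing.scale /= mulrCA mulNr (mulNr _^-1) mulVf // mulrN1 opprK.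
  + by rewrite mulr0 c1 cos0.
Qed.

(** The integers from -N to N - 1: asymmetric in order to match the pairing of k with -(k+1) in
    [summableZ]. *)
Definition zr N : seq int :=
  [seq k%:Z | k <- iota 0 N] ++ [seq - (k.+1)%:Z | k <- iota 0 N].

Lemma zr_uniq N : uniq (zr N).
Proof.
have injP : injective (fun k : nat => k%:Z) by move=> i j [].
have injN : injective (fun k : nat => - k.+1%:Z) by move=> i j /oppr_inj [].
rewrite cat_uniq (map_inj_uniq injP) (map_inj_uniq injN) !iota_uniq /=.
by rewrite andbT; apply/hasPn => _ /mapP[k _ ->]; apply/mapP => -[j _].
Qed.

Lemma big_zr (V : nmodType) N (F : int -> V) :
  \sum_(n <- zr N) F n = \sum_(0 <= k < N) (F k%:Z + F (- (k.+1)%:Z)).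
Proof. by rewrite big_cat !big_map big_split /= /index_iota subn0. Qed.

Lemma zr_le N M : (N <= M)%N -> {subset zr N <= zr M}.
Proof.
move=> NM n; rewrite !mem_cat => /orP[]/mapP[k]; rewrite mem_iota => /andP[_ kN] ->.
  by apply/orP; left; apply/mapP; exists k; rewrite // mem_iota (leq_trans kN).
by apply/orP; right; apply/mapP; exists k; rewrite // mem_iota (leq_trans kN).
Qed.

Lemma mem_zr (n : int) N : (`|n| < N)%N -> n \in zr N.
Proof.
rewrite mem_cat; case: n => k kN; apply/orP; [left|right]; apply/mapP; exists k => //.
  by rewrite mem_iota.
by rewrite mem_iota; exact: leq_trans kN.
Qed.

Definition trig b s (t : R) : R[i] := \sum_(n <- s) b n * expi n t.

Lemma L2T_trig b s : L2T (trig b s).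
Proof. by apply: L2T_sum => n; apply: L2TZ; exact: L2T_expi. Qed.

Lemma expi_mulJ n m (t : R) : expi n t * (expi m t)^* = expi (n - m) t.
Proof. by rewrite -expiN -expiD. Qed.

Lemma cint_trig_expiJ b s n : uniq s ->
  cint (fun t => trig b s t * (expi n t)^*) =
  if n \in s then (2 * pi)%:C * b n else 0.
Proof.
move=> us; have ci m : cintegrable (fun t : R => b m * (expi m t * (expi n t)^*)).
  by apply: cintegrableZ; apply: L2T_mulJ; exact: L2T_expi.
rewrite (eq_cint (g := fun t => \sum_(m <- s) b m * (expi m t * (expi n t)^*))); last first.
  by move=> t _; rewrite mulr_suml; apply: eq_bigr => m _; rewrite mulrA.
rewrite cint_sum//.
have E m : cint (fun t : R => b m * (expi m t * (expi n t)^*)) =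
    if m == n then (2 * pi)%:C * b n else 0.
  rewrite cintZ; last by apply: L2T_mulJ; exact: L2T_expi.
  rewrite (eq_cint (fun t _ => expi_mulJ m n t)) cint_expi subr_eq0.
  by case: eqP => [->|_]; rewrite ?mulr0// mulrC.
under eq_bigr do rewrite E.
rewrite -big_mkcond /=; case: ifPn => ns; last first.
  by rewrite big1_seq// => m /andP[/eqP ->]; rewrite (negPf ns).
by rewrite -big_filter filter_pred1_uniq// big_seq1.
Qed.

Lemma normsq_cint f : L2T f -> (normsq f)%:C = cint (fun t => f t * (f t)^*).
Proof.
move=> Lf; apply/eqP; rewrite eq_complex /=; apply/andP; split; apply/eqP.
  by apply: eq_Rintegral => t _; rewrite mulcJ.
rewrite -[LHS](mul0r (fine (mu I))) -Rintegral_cst; last exact: measurable_Tset.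
by apply: eq_Rintegral => t _; rewrite mulcJ.
Qed.

Lemma normsq_trig b s : uniq s ->
  normsq (trig b s) = 2 * pi * \sum_(n <- s) cmod (b n) ^+ 2.
Proof.
move=> us; apply: complexI; rewrite normsq_cint; last exact: L2T_trig.
have ci n : cintegrable (fun t : R => (b n)^* * (trig b s t * (expi n t)^*)).
  by apply: cintegrableZ; apply: L2T_mulJ; [exact: L2T_trig|exact: L2T_expi].
rewrite (eq_cint (g := fun t => \sum_(n <- s) (b n)^* * (trig b s t * (expi n t)^*))); last first.
  move=> t _; rewrite {2}/trig rmorph_sum mulr_sumr; apply: eq_bigr => n _.
  by rewrite rmorphM mulrCA.
rewrite cint_sum// rmorphM rmorph_sum mulr_sumr; apply: eq_big_seq => n ns.
rewrite cintZ; last by apply: L2T_mulJ; [exact: L2T_trig|exact: L2T_expi].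
by rewrite cint_trig_expiJ// ns mulrCA (mulrC (b n)^*) mulcJ.
Qed.

Lemma normsqD f g : L2T f -> L2T g -> normsq (fun t => f t + g t) =
  normsq f + 2 * complex.Re (cint (fun t => f t * (g t)^*)) + normsq g.
Proof.
move=> Lf Lg; have [ci _] := L2T_mulJ Lf Lg.
have mT := @measurable_Tset R.
rewrite /normsq /cint /= -RintegralZl// -RintegralD//; last first.
- exact: rintZ.
- exact: L2T_rint.
rewrite -RintegralD//; last first.
- exact: L2T_rint.
- by apply: rintD; [exact: L2T_rint|exact: rintZ].
apply: eq_Rintegral => t _; rewrite sqr_cmodD.
by rewrite !ReM; case: (f t) (g t) => a c [d e] /=; congr (_ + _ * _ + _); ring.
Qed.

Lemma fourier_cint f n : cint (fun t => f t * (expi n t)^*) = (2 * pi)%:C * fourier_coef f n.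
Proof.
rewrite fourier_coefE mulrA -rmorphM mulfV ?gt_eqF ?pi2_gt0// mul1r.
by apply: eq_cint => t _; rewrite expiN.
Qed.

(** The difference of the two errors is a combination of exponentials with frequencies in [s],
    orthogonal to f minus its Fourier sum; Pythagoras concludes. *)
Lemma best_approx f b s : uniq s -> L2T f ->
  normsq (fun t => f t - trig (fourier_coef f) s t) <= normsq (fun t => f t - trig b s t).
Proof.
move=> us Lf; set c := fourier_coef f.
pose d n := c n - b n.
have LS := L2T_trig c s; have LfS := L2TB Lf LS; have Ld := L2T_trig d s.
have -> : normsq (fun t => f t - trig b s t) =
    normsq (fun t => (f t - trig c s t) + trig d s t).
  congr normsq; apply/funext => t; rewrite /trig -addrA; congr (_ + _).
  rewrite -sumrN -sumrN -big_split; apply: eq_bigr => n _ /=.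
  by rewrite /d; ring.
rewrite (normsqD LfS Ld) (_ : cint _ = 0).
  by rewrite mulr0 addr0 lerDl normsq_ge0.
have ci n : cintegrable (fun t : R => (d n)^* * ((f t - trig c s t) * (expi n t)^*)).
  by apply: cintegrableZ; apply: L2T_mulJ => //; exact: L2T_expi.
rewrite (eq_cint (g := fun t => \sum_(n <- s) (d n)^* * ((f t - trig c s t) * (expi n t)^*))); last first.
  move=> t _; rewrite {2}/trig rmorph_sum mulr_sumr; apply: eq_bigr => n _.
  by rewrite rmorphM mulrCA.
rewrite cint_sum// big1_seq// => n /andP[_ ns].
rewrite cintZ; last by apply: L2T_mulJ => //; exact: L2T_expi.
rewrite (eq_cint (g := fun t => f t * (expi n t)^* + (-1) * (trig c s t * (expi n t)^*))); last first.
  by move=> t _; ring.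
have c1 : cintegrable (fun t => f t * (expi n t)^*) by apply: L2T_mulJ => //; exact: L2T_expi.
have c2 : cintegrable (fun t => trig c s t * (expi n t)^*) by apply: L2T_mulJ => //; exact: L2T_expi.
rewrite cintD//; last exact: cintegrableZ.
by rewrite cintZ// cint_trig_expiJ// ns fourier_cint mulN1r subrr mulr0.
Qed.

End fourier.

(** * Density of trigonometric polynomials *)

Section density.
Context {R : realType}.
Notation mu := (@lebesgue_measure R).
Notation I := (@Tset R).
Implicit Types (f g T : R -> R[i]) (b : int -> R[i]) (u v : R -> R).

(** Pairs of a coefficient and a frequency, repetitions allowed, so that sums and products of
    trigonometric polynomials are plain list operations. *)
Definition ptrig (s : seq (R[i] * int)) (t : R) : R[i] := \sum_(p <- s) p.1 * expi p.2 t.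

Lemma ptrig_trig (m : nat) s : exists N b, (m <= N)%N /\ forall t, ptrig s t = trig b (zr N) t.
Proof.
pose N := (m + (\sum_(p <- s) `|p.2|%N).+1)%N.
exists N, (fun n => \sum_(p <- s | p.2 == n) p.1); split; first exact: leq_addr.
move=> t; rewrite /trig; under eq_bigr do rewrite mulr_suml.
rewrite (exchange_big_dep predT)//= /ptrig; apply: eq_big_seq => p ps.
have pN : p.2 \in zr N.
  apply: mem_zr; rewrite /N addnS ltnS (leq_trans _ (leq_addl _ _))//.
  by rewrite (big_rem p ps) /= leq_addr.
under eq_bigl do rewrite eq_sym.
by rewrite -big_filter filter_pred1_uniq ?zr_uniq// big_seq1.
Qed.

Lemma L2T_ptrig s : L2T (ptrig s).
Proof. by apply: L2T_sum => p; apply: L2TZ; exact: L2T_expi. Qed.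

Lemma ptrig_cat s1 s2 t : ptrig (s1 ++ s2) t = ptrig s1 t + ptrig s2 t.
Proof. by rewrite /ptrig big_cat. Qed.

Lemma ptrig_scale c s t : ptrig [seq (c * p.1, p.2) | p <- s] t = c * ptrig s t.
Proof. by rewrite /ptrig big_map mulr_sumr; apply: eq_bigr => p _; rewrite mulrA. Qed.

Lemma ptrig_mul s1 s2 : exists s, forall t, ptrig s t = ptrig s1 t * ptrig s2 t.
Proof.
exists [seq (p.1 * q.1, p.2 + q.2) | p <- s1, q <- s2] => t.
rewrite /ptrig big_allpairs_dep mulr_suml; apply: eq_bigr => p _.
rewrite mulr_sumr; apply: eq_bigr => q _ /=; rewrite expiD; ring.
Qed.

Definition approximable f := forall eta, 0 < eta ->
  exists s, normsq (fun t => f t - ptrig s t) <= eta.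

(** The half of Parseval that needs completeness. Some Fourier sum of large degree J is close to f
    by [best_approx], and the frequencies between degrees m and J have explicit norm at most 2 pi
    delta; splitting the square of the sum doubles this. *)
Lemma fourier_tail f (m : nat) delta : L2T f -> approximable f ->
  (forall J, \sum_(m <= k < J) (cmod (fourier_coef f k%:Z) ^+ 2 +
     cmod (fourier_coef f (- k.+1%:Z)) ^+ 2) <= delta) ->
  normsq (fun t => f t - trig (fourier_coef f) (zr m) t) <= 4 * pi * delta.
Proof.
move=> Lf apf tail; apply/ler_addgt0Pr => e e0.
have e20 : 0 < e / 2 by rewrite divr_gt0.
have [s sP] := apf _ e20; have [J [b [mJ bE]]] := ptrig_trig m s.
set c := fourier_coef f.
pose d n := if n \in zr m then 0 else c n.
have dE t : trig c (zr J) t - trig c (zr m) t = trig d (zr J) t.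
  rewrite /trig -[X in _ - X](_ : \sum_(n <- zr J) (if n \in zr m then c n else 0) * expi n t = _).
    by rewrite -sumrB; apply: eq_bigr => n _; rewrite /d; case: ifP => _; ring.
  under eq_bigr do rewrite (fun_if (fun x => x * _)) mul0r.
  rewrite -big_mkcond -big_filter; apply: perm_big; apply: uniq_perm.
  - by rewrite filter_uniq// zr_uniq.
  - exact: zr_uniq.
  by move=> n; rewrite mem_filter andb_idr// => nm; exact: zr_le nm.
have -> : normsq (fun t => f t - trig c (zr m) t) =
    normsq (fun t => (f t - trig c (zr J) t) + trig d (zr J) t).
  by congr normsq; apply/funext => t; rewrite -dE addrA subrK.
have LJ : L2T (fun t => f t - trig c (zr J) t) by apply: L2TB => //; exact: L2T_trig.
rewrite (le_trans (normsqD_le LJ (L2T_trig d (zr J))))//.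
have H1 : normsq (fun t => f t - trig c (zr J) t) <= e / 2.
  apply: le_trans sP; under [in leRHS]eq_fun do rewrite bE.
  exact: best_approx (zr_uniq J) Lf.
have H2 : normsq (trig d (zr J)) <= 2 * pi * delta.
  rewrite normsq_trig ?zr_uniq// ler_wpM2l ?(ltW pi2_gt0)//.
  rewrite big_zr; apply: le_trans (tail J).
  rewrite (@big_cat_nat _ _ _ m)//= big_nat big1 ?add0r => [|k /andP[_ km]].
    apply: ler_sum => k _; rewrite /d; apply: lerD;
      by case: ifP => _; rewrite // cmod0 expr0n sqr_ge0.
  rewrite /d !ifT ?cmod0 ?expr0n ?addr0//; last exact: mem_zr.
  by rewrite mem_cat; apply/orP; right; apply/mapP; exists k; rewrite // mem_iota.
have := H1; have := H2; set x := normsq _; set y := normsq _ => h2 h1.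
have -> : 4 * pi * delta + e = 2 * (e / 2) + 2 * (2 * pi * delta) by field.
by rewrite lerD// ler_pM2l.
Qed.

Lemma approximable_lim f : L2T f ->
  (forall eta, 0 < eta -> exists g, [/\ L2T g, approximable g &
     normsq (fun t => f t - g t) <= eta]) -> approximable f.
Proof.
move=> Lf H eta eta0; have eta4 : 0 < eta / 4 by rewrite divr_gt0.
have [g [Lg apg fg]] := H _ eta4; have [s gs] := apg _ eta4; exists s.
have -> : normsq (fun t => f t - ptrig s t) =
    normsq (fun t => (f t - g t) + (g t - ptrig s t)).
  by congr normsq; apply/funext => t; rewrite addrA subrK.
rewrite (le_trans (normsqD_le _ _))//; [exact: L2TB|exact: L2TB (L2T_ptrig s)|].
have -> : eta = 2 * (eta / 4) + 2 * (eta / 4) by field.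
by rewrite lerD// ler_pM2l.
Qed.

Lemma approximable_lincomb c f g : L2T f -> L2T g -> approximable f -> approximable g ->
  approximable (fun t => f t + c * g t).
Proof.
move=> Lf Lg apf apg eta eta0; have eta4 : 0 < eta / 4 by rewrite divr_gt0.
have c0 : 0 < cmod c ^+ 2 + 1 by rewrite ltr_wpDl ?sqr_ge0.
have [s1 s1P] := apf _ eta4.
have [s2 s2P] := apg _ (divr_gt0 eta4 c0).
exists (s1 ++ [seq (c * p.1, p.2) | p <- s2]).
have -> : normsq (fun t => f t + c * g t - ptrig (s1 ++ [seq (c * p.1, p.2) | p <- s2]) t) =
    normsq (fun t => (f t - ptrig s1 t) + c * (g t - ptrig s2 t)).
  by congr normsq; apply/funext => t; rewrite ptrig_cat ptrig_scale; ring.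
have L1 := L2TB Lf (L2T_ptrig s1); have L2 := L2TB Lg (L2T_ptrig s2).
rewrite (le_trans (normsqD_le L1 (L2TZ c L2)))//.
have -> : eta = 2 * (eta / 4) + 2 * (eta / 4) by field.
rewrite lerD// ler_pM2l//.
have -> : normsq (fun t => c * (g t - ptrig s2 t)) = cmod c ^+ 2 * normsq (fun t => g t - ptrig s2 t).
  rewrite /normsq -RintegralZl//; [|exact: measurable_Tset|exact: L2T_rint].
  by apply: eq_Rintegral => t _; rewrite cmodM exprMn.
rewrite ler_pdivlMr// in s2P; rewrite (le_trans _ s2P)// mulrC ler_wpM2l ?normsq_ge0//.
by rewrite lerDl.
Qed.

Lemma Rintegral_dct (u_ : nat -> R -> R) v eta : (forall n, measurable_fun I (u_ n)) ->
  rint v -> (forall n t, I t -> `|u_ n t| <= v t) ->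
  {ae mu, forall t, I t -> u_ ^~ t @ \oo --> 0} -> 0 < eta ->
  exists n, Rintegral mu I (u_ n) <= eta.
Proof.
move=> mu_ iv uv cu eta0.
have [] := @dominated_convergence _ _ _ mu _ (@measurable_Tset R) (fun n => EFin \o u_ n)
  (cst 0%E) (EFin \o v).
- by move=> n; apply/measurable_EFinP; exact: mu_.
- exact: measurable_cst.
- apply: negligibleS cu => t /= H ut; apply: H => It.
  by apply: cvg_EFin; [exact: nearW|exact: ut].
- exact: iv.
- by apply: aeW => t n It; rewrite /= lee_fin uv.
move=> _ _; rewrite integral0 => /fine_cvgP[_ /cvgrPdist_le /(_ _ eta0) [n _ /(_ n (leqnn n))]].
rewrite sub0r normrN => H; exists n; exact: le_trans (ler_norm _) H.
Qed.

End density.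

(** * Approximate identity by powers of the raised cosine *)

Section kernel.
Context {R : realType}.
Notation mu := (@lebesgue_measure R).
Notation I := (@Tset R).
Implicit Types (u v phi : R -> R) (J : nat).

(** This is cos(x/2)^(2J), the de la Vallee Poussin kernel before normalisation: a nonnegative
    trigonometric polynomial concentrating at 0 modulo 2 pi. *)
Definition ck J (x : R) : R := ((1 + cos x) / 2) ^+ J.

Lemma ck_base_itv (x : R) : 0 <= (1 + cos x) / 2 <= 1.
Proof. by have := cos_le1 x; have := cos_geN1 x; lra. Qed.

Lemma ck_ge0 J x : 0 <= ck J x.
Proof. by have /andP[c0 _] := ck_base_itv x; rewrite exprn_ge0. Qed.

Lemma ck_le1 J x : ck J x <= 1.
Proof. by have /andP[c0 c1] := ck_base_itv x; rewrite exprn_ile1. Qed.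

Lemma ck_ptrig J : exists s, forall x, (ck J x)%:C = ptrig s x.
Proof.
elim: J => [|J [s sP]].
  by exists [:: (1, 0)] => x; rewrite /ptrig big_seq1 expi0 mulr1.
have [s' s'P] := ptrig_mul s [:: (2^-1, 0); (4^-1, 1); (4^-1, -1)].
exists s' => x; rewrite s'P -sP /ck exprSr rmorphM /=; congr (_ * _).
rewrite /ptrig !big_cons big_nil expi0 expiN addr0 mulr1 -mulrDr.
apply/eqP; rewrite eq_complex.
have -> : 2^-1 = ((2^-1 : R))%:C by rewrite fmorphV rmorph_nat.
have -> : 4^-1 = ((4^-1 : R))%:C by rewrite fmorphV rmorph_nat.
rewrite ReD ImD ReZ ImZ /= mul1r; by apply/andP; split; apply/eqP; field.
Qed.

Lemma continuous_ck J t : continuous (fun s : R => ck J (t - s)).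
Proof.
move=> s; rewrite /ck.
apply: (@continuous_comp _ _ _ (fun s : R => (1 + cos (t - s)) / 2) (fun x => x ^+ J)).
  apply: cvgM; last exact: cvg_cst.
  apply: cvgD; first exact: cvg_cst.
  apply: continuous_comp; last exact: continuous_cos.
  by apply: cvgB; [exact: cvg_cst|exact: cvg_id].
exact: exprn_continuous.
Qed.

Lemma measurable_ck J t : measurable_fun I (fun s : R => ck J (t - s)).
Proof.
apply: measurable_funS (@subsetT _ _) _ => //.
by apply: continuous_measurable_fun; exact: continuous_ck.
Qed.

Lemma expiB n (t s : R) : expi n (t - s) = expi n t * expi (- n) s.
Proof.
rewrite /expi mulrBr rmorphN mulNr cosB sinB cosN sinN.
by apply/eqP; rewrite eq_complex /=; apply/andP; split; apply/eqP; ring.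
Qed.

Lemma cint_real u : cint (fun s => (u s)%:C) = (Rintegral mu I u)%:C.
Proof.
by rewrite /cint /= Rintegral_cst ?mul0r//; exact: measurable_Tset.
Qed.

Definition ckconv J u t : R := Rintegral mu I (fun s => ck J (t - s) * u s).

Lemma L2T_real u K : measurable_fun I u -> (forall s, I s -> `|u s| <= K) ->
  L2T (fun s => (u s)%:C).
Proof.
move=> mu_ uK; apply: (@L2T_bounded _ _ K); last by move=> t It; rewrite cmod_real uK.
by split => //; exact: measurable_cst.
Qed.

Lemma ckconv_sum J u K s : measurable_fun I u -> (forall s, I s -> `|u s| <= K) ->
  (forall x, (ck J x)%:C = ptrig s x) -> forall t,
  (ckconv J u t)%:C = ptrig [seq (p.1 * cint (fun r => (u r)%:C * (expi p.2 r)^*), p.2) | p <- s] t.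
Proof.
move=> mu_ uK sP t; have Lu := L2T_real mu_ uK.
rewrite -cint_real /ptrig big_map /=.
have ci (p : R[i] * int) : cintegrable (fun r => (p.1 * expi p.2 t) * ((u r)%:C * (expi p.2 r)^*)).
  by apply: cintegrableZ; apply: L2T_mulJ => //; exact: L2T_expi.
rewrite (eq_cint (g := fun r => \sum_(p <- s) (p.1 * expi p.2 t) * ((u r)%:C * (expi p.2 r)^*))).
  rewrite cint_sum//; apply: eq_bigr => p _.
  rewrite cintZ; last by apply: L2T_mulJ => //; exact: L2T_expi.
  by rewrite mulrAC.
move=> r _; have -> : (ck J (t - r) * u r)%:C = ptrig s (t - r) * (u r)%:C.
  by rewrite rmorphM /= sP.
rewrite mulr_suml; apply: eq_bigr => p _.
by rewrite expiB expiN; ring.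
Qed.

Definition ckmass J : R := ckconv J (fun=> 1) 0.

(** Independence of t is read off the Fourier expansion, where only frequency 0 survives, instead of
    a periodic change of variable. *)
Lemma ckconv1 J t : ckconv J (fun=> 1) t = ckmass J.
Proof.
have [s sP] := ck_ptrig J.
apply: complexI; rewrite /ckmass.
have m1 : measurable_fun I (fun _ : R => 1 : R) by exact: measurable_cst.
have b1 r : I r -> `|1 : R| <= 1 by rewrite normr1.
rewrite !(ckconv_sum m1 b1 sP) /ptrig !big_map; apply: eq_bigr => p _ /=.
rewrite (eq_cint (g := fun r => expi (- p.2) r)); last first.
  by move=> r _; rewrite mul1r expiN.
rewrite cint_expi oppr_eq0; case: eqP => [->|_]; last by rewrite mulr0 !mul0r.
by rewrite !expi0.
Qed.

Lemma rint_ckM J u K t : measurable_fun I u -> (forall s, I s -> `|u s| <= K) ->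
  rint (fun s => ck J (t - s) * u s).
Proof.
move=> mu_ uK; apply: (@rint_bounded _ _ K).
  by apply: measurable_funM => //; exact: measurable_ck.
move=> s Is; rewrite normrM ger0_norm ?ck_ge0//.
by rewrite (le_trans _ (uK s Is))// ler_piMl// ck_le1.
Qed.

Lemma rint_ck J t : rint (fun s => ck J (t - s)).
Proof.
by apply: (@rint_bounded _ _ 1) => [|s _]; [exact: measurable_ck|
  rewrite ger0_norm ?ck_ge0 ?ck_le1].
Qed.

Lemma ckmassE J t : ckmass J = Rintegral mu I (fun s => ck J (t - s)).
Proof. by rewrite -(ckconv1 J t); apply: eq_Rintegral => s _; rewrite mulr1. Qed.

(** The mass is computed at the centre pi, where the interval from pi to pi + e stays inside [Tset];
    on it the kernel is at least its value at distance e. *)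
Lemma ckmass_ge J (e : R) : 0 < e <= 1 -> e * ((1 + cos e) / 2) ^+ J <= ckmass J.
Proof.
move=> /andP[e0 e1]; have pi2 := pi_ge2 R.
rewrite (ckmassE J pi).
set q := (1 + cos e) / 2; have /andP[q0 _] := ck_base_itv e.
pose A := `[pi, pi + e]%classic : set R.
have mA : measurable A by exact: measurable_itv.
have AI : A `<=` I.
  move=> s; rewrite /A /Tset /= !in_itv /= => /andP[s1 s2]; apply/andP; split; lra.
have le1 s : A s -> q ^+ J <= ck J (pi - s).
  rewrite /A /= in_itv /= => /andP[s1 s2]; apply: lerXn2r; first exact: q0.
    by have /andP[] := ck_base_itv (pi - s).
  rewrite ler_pM2r// lerD2l -(cosN (pi - s)) opprB.
  have [->//|ne] := eqVneq (s - pi) e.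
  have spi : s - pi \in `[0, pi]%R by rewrite in_itv /=; apply/andP; split; lra.
  have epi : e \in `[0, pi]%R by rewrite in_itv /=; apply/andP; split; lra.
  by rewrite ltW// (ltr_cos spi epi) lt_neqAle ne /=; lra.
have ick := rint_ck J pi.
rewrite -lee_fin /Rintegral fineK; last first.
  by apply: integrable_fin_num ick; exact: measurable_Tset.
apply: (@le_trans _ _ (\int[mu]_(s in A) (ck J (pi - s))%:E)%E); last first.
  apply: ge0_subset_integral => //.
  - exact: measurable_Tset.
  - by apply/measurable_EFinP; exact: measurable_ck.
  - by move=> s _; rewrite lee_fin ck_ge0.
apply: (@le_trans _ _ (\int[mu]_(s in A) (q ^+ J)%:E)%E).
  have mAe : mu A = e%:E.
    by rewrite /A lebesgue_measure_itv /= lte_fin ltrDl e0 -EFinD addrC addKr.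
  have -> : (\int[mu]_(s in A) (q ^+ J)%:E = (q ^+ J * e)%:E)%E.
    by rewrite integral_cst//= EFinM; congr (_ * _)%E; exact: mAe.
  by rewrite lee_fin mulrC.
apply: ge0_le_integral => //.
- by move=> s _; rewrite lee_fin exprn_ge0.
- by apply/measurable_EFinP; apply: measurable_funS AI _; [exact: measurable_Tset|exact: measurable_ck].
Qed.

Lemma ckmass_gt0 J : 0 < ckmass J.
Proof.
have e01 : 0 < (1 / 2 : R) <= 1 by apply/andP; split; lra.
apply: lt_le_trans (ckmass_ge J e01).
rewrite mulr_gt0 ?exprn_gt0//.
have : 0 < cos (1 / 2) :> R.
  apply: cos_gt0_pihalf; have := pihalf_ge1 R => h; apply/andP; split; lra.
lra.
Qed.

Lemma cos_far (d x : R) : 0 <= d -> d <= `|x| <= 2 * pi - d -> cos x <= cos d.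
Proof.
move=> d0 /andP[dx xd]; have pi0 := pi_gt0 R.
have -> : cos x = cos `|x|.
  by case: (ger0P x) => _; rewrite ?cosN.
set y := `|x| in dx xd *.
wlog ypi : y dx xd / y <= pi.
  move=> H; case: (leP y pi) => [|ypi]; first exact: H.
  have -> : cos y = cos (2 * pi - y).
    by rewrite -[RHS]cosN opprB mulr_natl -[in LHS](subrK (pi *+ 2) y) cosD2pi.
  by apply: H; lra.
have [->//|ne] := eqVneq y d.
have yI : y \in `[0, pi]%R by rewrite in_itv /=; apply/andP; split; lra.
have dI : d \in `[0, pi]%R by rewrite in_itv /=; apply/andP; split; lra.
by rewrite ltW// (ltr_cos dI yI) lt_neqAle eq_sym ne dx.
Qed.

(** At distance at least d the kernel is at most Q^J, while its mass is at least (d/2) Q'^J with Q'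
    > Q taken at distance d/2. The far part is thus of order (Q/Q')^J relative to the mass;
    continuity handles the near part. *)
Lemma ckconv_cvg phi K t : continuous phi -> (forall s, `|phi s| <= K) -> 0 < t < 2 * pi ->
  (fun J => ckconv J phi t / ckmass J) @ \oo --> phi t.
Proof.
move=> cphi phiK /andP[t0 t2]; have K0 : 0 <= K by apply: le_trans (phiK 0).
have mT := @measurable_Tset R.
have mphi : measurable_fun I phi.
  apply: measurable_funS (@subsetT _ _) _ => //.
  exact: continuous_measurable_fun.
apply/cvgrPdist_le => e e0.
have e2 : 0 < e / 2 by rewrite divr_gt0.
have [d1 /= d10 d1P] : exists2 d1 : R, 0 < d1 & forall s, `|t - s| < d1 -> `|phi t - phi s| <= e / 2.
  have /cvgrPdist_le /(_ _ e2) [d1 d10 H] := cphi t.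
  by exists d1 => // s ts; apply: H.
(* d <= t and d <= 2 pi - t ensure |t - s| <= 2 pi - d on the domain, so no far point is near t
   modulo 2 pi; this is why t is interior. *)
pose d := Num.min (Num.min d1 1) (Num.min t (2 * pi - t)).
have d0 : 0 < d by rewrite !lt_min d10 t0 subr_gt0 t2 ltr01.
have dd1 : d <= d1 by rewrite !ge_min lexx.
have dle1 : d <= 1 by rewrite !ge_min lexx orbT.
have dt : d <= t by rewrite !ge_min lexx !orbT.
have dt2 : d <= 2 * pi - t by rewrite !ge_min lexx !orbT.
pose Q := (1 + cos d) / 2; pose Q' := (1 + cos (d / 2)) / 2.
have pi2 := pi_ge2 R.
have QQ' : Q < Q'.
  have a1 : d \in `[0, pi]%R by rewrite in_itv /=; apply/andP; split; lra.
  have a2 : d / 2 \in `[0, pi]%R by rewrite in_itv /=; apply/andP; split; lra.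
  by rewrite ltr_pM2r// ltrD2l (ltr_cos a2 a1); lra.
have /andP[Q0 _] : 0 <= Q <= 1 := ck_base_itv d.
have Q'0 : 0 < Q' by apply: le_lt_trans QQ'.
have ratio : 0 <= Q / Q' < 1 by rewrite divr_ge0 ?(ltW Q'0)//= ltr_pdivrMr// mul1r.
pose D := 4 * pi * K / (d / 2) + 1.
have D0 : 0 < D.
  by rewrite ltr_wpDl// divr_ge0 ?mulr_ge0 ?(ltW (pi_gt0 R)) ?(ltW d0).
have rcvg : (fun J => (Q / Q') ^+ J) @ \oo --> (0 : R).
  by apply: cvg_expr; rewrite ger0_norm; case/andP: ratio.
have /cvgrPdist_le /(_ _ (divr_gt0 e2 D0)) [N _ NP] := rcvg.
exists N => // J /= NJ; have {NP} := NP J NJ; rewrite sub0r normrN => rJ.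
have m0 := ckmass_gt0 J.
have ic := rint_ck J t; have icphi := rint_ckM J t mphi (fun s _ => phiK s).
rewrite -(ler_pM2r m0) -[X in _ * X](gtr0_norm m0) -normrM mulrBl divfK ?gt_eqF//.
have -> : phi t * ckmass J - ckconv J phi t =
    Rintegral mu I (fun s => phi t * ck J (t - s) - ck J (t - s) * phi s).
  by rewrite RintegralB//; [rewrite RintegralZl// -ckmassE|exact: rintZ].
have idiff := rintB (rintZ (phi t) ic) icphi.
apply: le_trans; first by apply: le_normr_Rintegral; [exact: mT|exact: idiff].
have rint_cst (c : R) : rint (fun _ : R => c).
  by apply: (@rint_bounded _ _ `|c|) => //; exact: measurable_cst.
have ib : rint (fun s => e / 2 * ck J (t - s) + 2 * K * Q ^+ J).
  by apply: rintD => //; exact: rintZ.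
have idiff' : rint (fun s => `|phi t * ck J (t - s) - ck J (t - s) * phi s|).
  by have := integrable_norm idiff.
apply: (@le_trans _ _ (Rintegral mu I (fun s => e / 2 * ck J (t - s) + 2 * K * Q ^+ J))).
  apply: le_Rintegral => //.
  move=> s Is; rewrite mulrC -mulrBr normrM ger0_norm ?ck_ge0//.
  have KQ0 : 0 <= 2 * K * Q ^+ J by rewrite !mulr_ge0 ?exprn_ge0.
  have eck0 : 0 <= e / 2 * ck J (t - s) by rewrite mulr_ge0 ?ck_ge0 ?ltW.
  have [tsd|tsd] := ltP `|t - s| d.
    rewrite -[leLHS]addr0 lerD// mulrC ler_wpM2r ?ck_ge0//.
    by apply: d1P; apply: lt_le_trans dd1.
  rewrite -[leLHS]add0r lerD// mulrC ler_pM ?ck_ge0//.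
    rewrite (le_trans (ler_normB _ _))// mulr_natl mulr2n lerD//.
  apply: lerXn2r; rewrite ?nnegrE//.
  rewrite ler_pM2r// lerD2l cos_far ?(ltW d0)// tsd /=.
  move: Is; rewrite /Tset /= in_itv /= => /andP[s0 s2]; rewrite ler_norml.
  by apply/andP; split; lra.
rewrite RintegralD//; [|exact: rintZ|exact: rint_cst].
rewrite RintegralZl// -ckmassE Rintegral_cst//.
have -> : fine (mu I) = 2 * pi by exact: (congr1 fine mu_Tset).
have -> : e * ckmass J = e / 2 * ckmass J + e / 2 * ckmass J by field.
rewrite lerD2l.
have dI : 0 < d / 2 <= 1 by apply/andP; split; lra.
have := ckmass_ge J dI; rewrite -/Q' => mge.
have -> : 2 * K * Q ^+ J * (2 * pi) = 4 * pi * K / (d / 2) * (Q / Q') ^+ J * (d / 2 * Q' ^+ J).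
  have fld (k x y c p : R) : c != 0 -> y != 0 ->
      2 * k * x * (2 * p) = 4 * p * k / (c / 2) * (x / y) * (c / 2 * y).
    by move=> cn yn; field; rewrite yn cn.
  by rewrite (expr_div_n Q); apply: fld; rewrite ?expf_neq0// gt_eqF.
have X0 : 0 <= (Q / Q') ^+ J by rewrite exprn_ge0//; case/andP: ratio.
have Y0 : 0 <= d / 2 * Q' ^+ J by rewrite mulr_ge0 ?exprn_ge0 ?(ltW Q'0) ?divr_ge0 ?(ltW d0).
apply: (@le_trans _ _ (e / 2 * (d / 2 * Q' ^+ J))); last by rewrite ler_pM2l.
rewrite ger0_norm// ler_pdivlMr// in rJ; rewrite ler_wpM2r//.
by apply: le_trans rJ; rewrite mulrC ler_wpM2l// lerDl.
Qed.

End kernel.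

(** * Trigonometric polynomials are dense: continuous, bounded, then square-integrable functions *)

Section density.
Context {R : realType}.
Notation mu := (@lebesgue_measure R).
Notation I := (@Tset R).
Implicit Types (u v phi : R -> R) (K x y : R).

Lemma approximable_continuous phi K : continuous phi -> (forall s, `|phi s| <= K) ->
  approximable (fun t => (phi t)%:C).
Proof.
move=> cphi phiK eta eta0.
have mphi : measurable_fun I phi.
  apply: measurable_funS (@subsetT _ _) _ => //.
  exact: continuous_measurable_fun.
have phiKI s : I s -> `|phi s| <= K by [].
have mT := @measurable_Tset R.
have convP J : exists s, forall t, (ckconv J phi t / ckmass J)%:C = ptrig s t.
  have [s sP] := @ck_ptrig R J.
  exists [seq (((ckmass J)^-1)%:C * p.1, p.2) |
    p <- [seq (p.1 * cint (fun r => (phi r)%:C * (expi p.2 r)^*), p.2) | p <- s]] => t.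
  by rewrite ptrig_scale -(ckconv_sum mphi phiKI sP) mulrC rmorphM.
pose u_ J t := (phi t - ckconv J phi t / ckmass J) ^+ 2.
have mconv J : measurable_fun I (fun t => ckconv J phi t / ckmass J).
  have [s sP] := convP J; have [[mR _] _] := L2T_ptrig s.
  by apply: eq_measurable_fun mR => t _; rewrite -sP.
have bconv J t : `|ckconv J phi t / ckmass J| <= K.
  have m0 : 0 < @ckmass R J by exact: ckmass_gt0.
  rewrite normrM normfV (gtr0_norm m0) ler_pdivrMr//.
  have ic := rint_ck J t; have icphi := rint_ckM J t mphi phiKI.
  apply: le_trans; first by apply: le_normr_Rintegral; [exact: mT|exact: icphi].
  rewrite (ckmassE J t) -RintegralZl//; apply: le_Rintegral => //.
  - by have := integrable_norm icphi.
  - exact: rintZ.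
  - by move=> s Is; rewrite normrM ger0_norm ?ck_ge0// mulrC ler_wpM2r ?ck_ge0.
have mu_ J : measurable_fun I (u_ J) by apply: measurable_funX; exact: measurable_funB.
have iv : rint (fun _ : R => (K + K) ^+ 2).
  apply: (@rint_bounded _ _ `|(K + K) ^+ 2|) => //; exact: measurable_cst.
have uv J t : I t -> `|u_ J t| <= (K + K) ^+ 2.
  move=> _; rewrite normrX; have K0 : 0 <= K by apply: le_trans (phiK 0).
  by apply: lerXn2r; rewrite ?nnegrE ?addr_ge0// (le_trans (ler_normB _ _))// lerD.
(* [phi] may take different values at 0 and 2 pi, so convergence is claimed off these two points
   only. *)
have cu : {ae mu, forall t, I t -> u_ ^~ t @ \oo --> 0}.
  exists ([set 0] `|` [set 2 * pi]); split.
  - exact: measurableU.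
  - apply/eqP; rewrite eq_le measure_ge0 andbT.
    apply: (le_trans (measureU2 _ _ _)) => //.
    rewrite -[leRHS]adde0; apply: leeD; rewrite le_eqVlt; apply/orP; left; apply/eqP;
      exact: lebesgue_measure_set1.
  move=> t /=; apply: contraPP => /not_orP[t0 t2] nP; apply: nP.
  rewrite /Tset /= in_itv /= => /andP[le0 le2].
  have t02 : 0 < t < 2 * pi.
    by rewrite !lt_neqAle le0 le2 !andbT; apply/andP; split; apply/eqP => // /esym.
  rewrite -[X in _ --> X](_ : (phi t - phi t) ^+ 2 = 0); last by rewrite subrr expr0n.
  rewrite expr2; under eq_fun do rewrite /u_ expr2.
  by apply: cvgM; apply: cvgB; (exact: cvg_cst || exact: ckconv_cvg).
have [J JP] := Rintegral_dct mu_ iv uv cu eta0.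
have [s sP] := convP J; exists s; apply: le_trans JP.
rewrite /normsq le_eqVlt; apply/orP; left; apply/eqP; apply: eq_Rintegral => t _.
by rewrite -sP -rmorphB /= cmod_real real_normK ?num_real.
Qed.

(** Truncation to the interval from -K to K, in a closed form that makes continuity immediate. *)
Definition clip (K x : R) : R := (`|x + K| - `|x - K|) / 2.

Lemma normr_clip K x : 0 <= K -> `|clip K x| <= K.
Proof.
move=> K0; rewrite /clip ler_norml.
by case: (ger0P (x + K)) => ?; case: (ger0P (x - K)) => ?; apply/andP; split; lra.
Qed.

Lemma clip_lip K x y : 0 <= K -> `|y| <= K -> `|y - clip K x| <= `|y - x|.
Proof.
move=> K0; rewrite /clip !ler_norml => /andP[y1 y2].
case: (ger0P (x + K)) => ?; case: (ger0P (x - K)) => ?; case: (ger0P (y - x)) => ?;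
  by apply/andP; split; lra.
Qed.

Lemma clip_id K x : `|x| <= K -> clip K x = x.
Proof.
rewrite ler_norml => /andP[x1 x2]; rewrite /clip.
by rewrite ger0_norm ?ler0_norm; lra.
Qed.

Lemma continuous_clip K : continuous (clip K).
Proof.
move=> x; apply: cvgM; last exact: cvg_cst.
by apply: cvgB; apply: cvg_norm; apply: cvgD; (exact: cvg_id || exact: cvg_cst).
Qed.

Lemma normsq_real u : normsq (fun t => (u t)%:C) = Rintegral mu I (fun t => u t ^+ 2).
Proof. by apply: eq_Rintegral => t _; rewrite cmod_real real_normK ?num_real. Qed.

(** Continuous functions approximate u in L^1. Clipping them at K does not increase the distance to
    u and bounds the difference by 2K, so the squared L^2 distance is at most 2K times the L^1
    distance. *)
Lemma approximable_bounded u K : measurable_fun I u -> (forall s, I s -> `|u s| <= K) ->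
  approximable (fun t => (u t)%:C).
Proof.
move=> mu_ uK; have mT := @measurable_Tset R.
have K0 : 0 <= K.
  by apply: le_trans (uK 0 _); rewrite // /Tset /= in_itv /= lexx ltW// pi2_gt0.
apply: approximable_lim => [|eta eta0]; first exact: L2T_real mu_ uK.
have iu : rint u by exact: rint_bounded mu_ uK.
have K1 : 0 < 2 * K + 1 by rewrite ltr_wpDl// mulr_ge0.
have [g_ [cg ig]] := approximation_continuous_integrable mT mu_Tset_fin iu.
move=> /fine_cvgP[_ /cvgrPdist_le /(_ _ (divr_gt0 eta0 K1)) [n _ /(_ n (leqnn n))]].
rewrite /= sub0r normrN => gn.
have cphi : continuous (clip K \o g_ n).
  by move=> x; apply: continuous_comp; [exact: cg|exact: continuous_clip].
have phiK s : `|(clip K \o g_ n) s| <= K by exact: normr_clip.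
have mphi : measurable_fun I (clip K \o g_ n).
  apply: measurable_funS (@subsetT _ _) _ => //.
  exact: continuous_measurable_fun.
exists (fun t => ((clip K \o g_ n) t)%:C); split.
- exact: (L2T_real (K := K) mphi).
- exact: (approximable_continuous cphi phiK).
have -> : normsq (fun t => (u t)%:C - ((clip K \o g_ n) t)%:C) =
    Rintegral mu I (fun t => (u t - clip K (g_ n t)) ^+ 2).
  rewrite -normsq_real; congr normsq; apply/funext => t; by rewrite rmorphB.
have id1 : rint (fun t => `|u t - g_ n t|).
  by have := integrable_norm (rintB iu (ig n)).
have md : measurable_fun I (fun t => (u t - clip K (g_ n t)) ^+ 2).
  by apply: measurable_funX; exact: measurable_funB.
have le1 t : I t -> (u t - clip K (g_ n t)) ^+ 2 <= 2 * K * `|u t - g_ n t|.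
  move=> It; rewrite -real_normK ?num_real// expr2 ler_pM//.
    by rewrite (le_trans (ler_normB _ _))// mulr_natl mulr2n lerD ?uK ?normr_clip.
  by rewrite clip_lip ?uK.
have id2 : rint (fun t => 2 * K * `|u t - g_ n t|) by exact: rintZ.
apply: (@le_trans _ _ (Rintegral mu I (fun t => 2 * K * `|u t - g_ n t|))).
  apply: le_Rintegral => //; apply: rint_le md _ id2 => t It.
  by rewrite ger0_norm ?sqr_ge0 ?le1.
rewrite RintegralZl//.
have gn' : Rintegral mu I (fun t => `|u t - g_ n t|) <= eta / (2 * K + 1).
  exact: le_trans (ler_norm _) gn.
apply: (@le_trans _ _ (2 * K * (eta / (2 * K + 1)))).
  by rewrite ler_wpM2l// mulr_ge0.
by rewrite mulrA ler_pdivrMr// mulrC ler_pM2l// lerDl.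
Qed.

(** The truncations of u converge to it in L^2 by dominated convergence, with u^2 as majorant. *)
Lemma approximable_real u : measurable_fun I u -> rint (fun t => u t ^+ 2) ->
  approximable (fun t => (u t)%:C).
Proof.
move=> mu_ iu2; have mT := @measurable_Tset R.
have Lu : L2T (fun t => (u t)%:C).
  split; first by split => //; exact: measurable_cst.
  by apply: eq_integrable iu2 => // t _; rewrite /= cmod_real real_normK ?num_real.
apply: approximable_lim => // eta eta0.
pose d n t := u t - clip n%:R (u t).
have mclip n : measurable_fun I (fun t => clip n%:R (u t)).
  apply: (measurableT_comp (f := clip n%:R)) => //.
  by apply: continuous_measurable_fun; exact: continuous_clip.
have md n : measurable_fun I (fun t => d n t ^+ 2).
  by apply: measurable_funX; exact: measurable_funB.
have dle n t : I t -> `|d n t ^+ 2| <= u t ^+ 2.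
  move=> _; rewrite normrX -[u t ^+ 2]real_normK ?num_real//.
  apply: lerXn2r; rewrite ?nnegrE// /d /clip.
  case: (ger0P (u t + n%:R)) => ?; case: (ger0P (u t - n%:R)) => ?;
    case: (ger0P (u t)) => ?; have n0 := ler0n R n;
    by rewrite ler_norml; apply/andP; split; lra.
have cd : {ae mu, forall t, I t -> (fun n => d n t ^+ 2) @ \oo --> (0 : R)}.
  apply: aeW => t It; apply/cvgrPdist_le => e e0.
  have [N NP] := nat_ge `|u t|; exists N => // n /= Nn.
  rewrite /d clip_id; last by rewrite (le_trans NP)// ler_nat.
  by rewrite subrr expr0n subrr normr0 ltW.
have [n dn] := Rintegral_dct md iu2 dle cd eta0.
have cb t : `|clip n%:R (u t)| <= n%:R by exact: normr_clip.
exists (fun t => (clip n%:R (u t))%:C); split.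
- exact: (L2T_real (K := n%:R) (mclip n)).
- exact: (approximable_bounded (K := n%:R) (mclip n)).
have -> : normsq (fun t => (u t)%:C - (clip n%:R (u t))%:C) =
    Rintegral mu I (fun t => d n t ^+ 2).
  by rewrite -normsq_real; congr normsq; apply/funext => t; rewrite rmorphB.
exact: dn.
Qed.

Theorem L2T_approximable (f : R -> R[i]) : L2T f -> approximable f.
Proof.
move=> Lf; have [[mR mI] if_] := Lf; have mT := @measurable_Tset R.
have i1 : rint (fun t => complex.Re (f t) ^+ 2).
  apply: rint_le if_; first exact: measurable_funX.
  by move=> t _; rewrite ger0_norm ?sqr_ge0// sqr_cmod lerDl sqr_ge0.
have i2 : rint (fun t => complex.Im (f t) ^+ 2).
  apply: rint_le if_; first exact: measurable_funX.
  by move=> t _; rewrite ger0_norm ?sqr_ge0// sqr_cmod lerDr sqr_ge0.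
have L2R (u : R -> R) : measurable_fun I u -> rint (fun t => u t ^+ 2) -> L2T (fun t => (u t)%:C).
  move=> mu_ iu; split; first by split => //; exact: measurable_cst.
  by apply: eq_integrable iu => // t _; rewrite /= cmod_real real_normK ?num_real.
have := approximable_lincomb (Complex 0 1) (L2R _ mR i1) (L2R _ mI i2)
  (approximable_real mR i1) (approximable_real mI i2).
rewrite (_ : (fun t => _) = f)//; apply/funext => t.
by rewrite [RHS]complexE.
Qed.

End density.

(** * The lacunary series *)

Section lacunary.
Context {R : realType}.
Notation mu := (@lebesgue_measure R).
Notation I := (@Tset R).
Variables (a : nat -> R) (nu : nat -> nat).
Hypothesis a_gt0 : forall k, 0 < a k.
Hypothesis a_half : forall k, a k.+1 <= a k / 2.
Hypothesis a0_half : a 0%N <= 1 / 2.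

Definition lac_part (K : nat) (t : R) : R[i] :=
  \sum_(0 <= k < K) (a k)%:C * expi (- (nu k)%:Z) t.

Definition lac (t : R) : R[i] :=
  Complex (limn (fun K => complex.Re (lac_part K t)))
          (limn (fun K => complex.Im (lac_part K t))).

Let a_ge0 k : 0 <= a k. Proof. exact: ltW. Qed.

Lemma sum_tail_le K L : \sum_(K <= k < L) a k <= 2 * a K.
Proof.
have [LK|KL] := leqP L K; first by rewrite big_geq// mulr_ge0.
rewrite -(subnKC (ltnW KL)); move: (L - K)%N => d {KL}.
elim: d K => [|d IHd] K; first by rewrite addn0 big_geq// mulr_ge0.
rewrite addnS big_ltn ?ltnS ?leq_addr// -addSn.
have := IHd K.+1; have := a_half K; lra.
Qed.

Lemma a_le_pow k : a k <= (1 / 2) ^+ k.+1.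
Proof.
elim: k => [|k IHk]; first by rewrite expr1.
rewrite [leRHS]exprSr; move: IHk (a_half k); move: (_ ^+ _) => x; lra.
Qed.

Lemma cmod_lac_partB K L t : (K <= L)%N -> cmod (lac_part L t - lac_part K t) <= 2 * a K.
Proof.
move=> KL; rewrite /lac_part (@big_cat_nat _ _ _ K)//= [X in cmod X]addrC addKr.
rewrite (le_trans (cmod_sum _ _ _))// (le_trans _ (sum_tail_le K L))// ler_sum// => k _.
by rewrite cmodM cmod_expi mulr1 ger0_cmod.
Qed.

Lemma is_cvg_geometric_cauchy (u : nat -> R) :
  (forall K L, (K <= L)%N -> `|u L - u K| <= 2 * a K) -> cvgn u.
Proof.
move=> uC; apply/cauchy_cvgP/cauchy_exP => e e0.
have h01 : 0 <= (1 / 2 : R) < 1 by apply/andP; split; lra.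
have e4 : 0 < e / 4 by rewrite divr_gt0.
have [N NP] := @exp_small R _ _ h01 e4.
exists (u N), N => // n /= Nn; rewrite -ball_normE /= distrC.
apply: le_lt_trans (uC _ _ Nn) _; have := a_le_pow N; rewrite exprS; lra.
Qed.

Lemma cvg_cauchy_le (u : nat -> R) K b : cvgn u ->
  (forall L, (K <= L)%N -> `|u L - u K| <= b) -> `|limn u - u K| <= b.
Proof.
move=> cu ub; apply/ler_addgt0Pr => e e0.
have /cvgrPdist_le /(_ _ e0) [N _ NP] := cu.
have := NP (maxn N K) (leq_maxl _ _); have := ub (maxn N K) (leq_maxr _ _) => h1 h2.
by rewrite (le_trans (ler_distD (u (maxn N K)) _ _))// addrC lerD.
Qed.

Lemma lac_part_Re K L t : (K <= L)%N ->
  `|complex.Re (lac_part L t) - complex.Re (lac_part K t)| <= 2 * a K.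
Proof.
move=> KL; apply: le_trans (cmod_lac_partB t KL).
by rewrite -ReN -ReD normr_Re_le.
Qed.

Lemma lac_part_Im K L t : (K <= L)%N ->
  `|complex.Im (lac_part L t) - complex.Im (lac_part K t)| <= 2 * a K.
Proof.
move=> KL; apply: le_trans (cmod_lac_partB t KL).
by rewrite -ImN -ImD normr_Im_le.
Qed.

Lemma is_cvg_lac_Re t : cvgn (fun K => complex.Re (lac_part K t)).
Proof. by apply: is_cvg_geometric_cauchy => K L; exact: lac_part_Re. Qed.

Lemma is_cvg_lac_Im t : cvgn (fun K => complex.Im (lac_part K t)).
Proof. by apply: is_cvg_geometric_cauchy => K L; exact: lac_part_Im. Qed.

(** The tail bound 2 a_K is used once for the real and once for the imaginary part, whence the 4. *)
Lemma cmod_lacB K t : cmod (lac t - lac_part K t) <= 4 * a K.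
Proof.
rewrite (le_trans (cmod_le_ReIm _))// ReD ReN ImD ImN /=.
have hR := cvg_cauchy_le (@is_cvg_lac_Re t) (fun L (KL : (K <= L)%N) => lac_part_Re t KL).
have hI := cvg_cauchy_le (@is_cvg_lac_Im t) (fun L (KL : (K <= L)%N) => lac_part_Im t KL).
rewrite /= in hR hI; lra.
Qed.

Lemma L2T_lac_part K : L2T (lac_part K).
Proof. by apply: L2T_sum => k; apply: L2TZ; exact: L2T_expi. Qed.

Lemma cmod_lac t : cmod (lac t) <= 2.
Proof.
have := cmod_lacB 0 t; rewrite /lac_part big_geq// subr0.
by move=> /le_trans; apply; have := a0_half; lra.
Qed.

Lemma L2T_lac : L2T lac.
Proof.
apply: (@L2T_bounded _ _ 2) => [|t _]; last exact: cmod_lac.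
split.
  apply: (measurable_fun_cvg (h := fun K t => complex.Re (lac_part K t))) => [K|t _].
    by have [[]] := L2T_lac_part K.
  exact: is_cvg_lac_Re.
apply: (measurable_fun_cvg (h := fun K t => complex.Im (lac_part K t))) => [K|t _].
  by have [[]] := L2T_lac_part K.
exact: is_cvg_lac_Im.
Qed.

Lemma cmod_fourier_le (f : R -> R[i]) n e : L2T f -> (forall t, I t -> cmod (f t) <= e) ->
  cmod (fourier_coef f n) <= 2 * e.
Proof.
move=> Lf fe; have mT := @measurable_Tset R.
have [cR cI] := L2T_mulJ Lf (L2T_expi n).
have p0 := @pi2_gt0 R.
have bnd (u : R -> R) : rint u -> (forall t, I t -> `|u t| <= e) ->
    `|Rintegral mu I u| <= e * (2 * pi).
  move=> iu ue; apply: le_trans; first by apply: le_normr_Rintegral; [exact: mT|exact: iu].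
  have -> : e * (2 * pi) = Rintegral mu I (fun=> e).
    by rewrite Rintegral_cst//; congr (_ * _); exact/esym/(congr1 fine mu_Tset).
  apply: le_Rintegral => //; first by have := integrable_norm iu.
  by apply: (@rint_bounded _ _ `|e|) => //; exact: measurable_cst.
have ub t : I t -> cmod (f t * (expi n t)^*) <= e.
  by move=> It; rewrite cmodM cmodJ cmod_expi mulr1 fe.
have h : cmod (cint (fun t => f t * (expi n t)^*)) <= 2 * (e * (2 * pi)).
  rewrite (le_trans (cmod_le_ReIm _))// mulr_natl mulr2n lerD//.
    by apply: bnd => // t It; rewrite (le_trans (normr_Re_le _))// ub.
  by apply: bnd => // t It; rewrite (le_trans (normr_Im_le _))// ub.
move: h; rewrite fourier_cint cmodM ger0_cmod ?(ltW p0)//.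
by rewrite mulrC mulrA ler_pM2r.
Qed.

Lemma fourierB (f g : R -> R[i]) n : L2T f -> L2T g ->
  fourier_coef (fun t => f t - g t) n = fourier_coef f n - fourier_coef g n.
Proof.
move=> Lf Lg.
have p0 : (2 * pi)%:C != 0 :> R[i].
  by apply/eqP => /complexI/eqP; rewrite gt_eqF// pi2_gt0.
apply: (mulfI p0); rewrite mulrBr -!fourier_cint.
have cf := L2T_mulJ Lf (L2T_expi n); have cg := L2T_mulJ Lg (L2T_expi n).
rewrite (eq_cint (g := fun t => f t * (expi n t)^* + (-1) * (g t * (expi n t)^*))); last first.
  by move=> t _; ring.
rewrite cintD//; last exact: cintegrableZ.
by rewrite cintZ// mulN1r.
Qed.

Lemma fourier_lac_part K n :
  fourier_coef (lac_part K) n = \sum_(0 <= k < K) (a k)%:C *+ (- (nu k)%:Z == n).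
Proof.
have p0 : (2 * pi)%:C != 0 :> R[i].
  by apply/eqP => /complexI/eqP; rewrite gt_eqF// pi2_gt0.
apply: (mulfI p0); rewrite -fourier_cint.
have ci k : cintegrable (fun t : R => (a k)%:C * (expi (- (nu k)%:Z) t * (expi n t)^*)).
  by apply: cintegrableZ; apply: L2T_mulJ; exact: L2T_expi.
rewrite (eq_cint (g := fun t => \sum_(0 <= k < K) (a k)%:C * (expi (- (nu k)%:Z) t * (expi n t)^*))); last first.
  by move=> t _; rewrite mulr_suml; apply: eq_bigr => k _; rewrite mulrA.
rewrite cint_sum// mulr_sumr; apply: eq_bigr => k _.
rewrite cintZ; last by apply: L2T_mulJ; exact: L2T_expi.
rewrite (eq_cint (fun t _ => expi_mulJ _ _ t)) cint_expi subr_eq0.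
by case: eqP => _; rewrite ?mulr1n ?mulr0n ?mulr0// mulrC.
Qed.

Lemma sum_fourier_lac_part K N :
  \sum_(n <- zr N) cmod (fourier_coef (lac_part K) n) <= 1.
Proof.
apply: (@le_trans _ _ (\sum_(n <- zr N) \sum_(0 <= k < K) a k *+ (- (nu k)%:Z == n))).
  apply: ler_sum => n _; rewrite fourier_lac_part (le_trans (cmod_sum _ _ _))//.
  by apply: ler_sum => k _; case: eqP => _; rewrite ?mulr1n ?mulr0n ?cmod0// ger0_cmod.
rewrite exchange_big /=; apply: (@le_trans _ _ (\sum_(0 <= k < K) a k)).
  apply: ler_sum => k _; under eq_bigr do rewrite mulrb eq_sym.
  rewrite -big_mkcond -big_filter.
  have [kN|kN] := boolP (- (nu k)%:Z \in zr N).
    by rewrite filter_pred1_uniq ?zr_uniq// big_seq1.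
  rewrite big_filter big1_seq// => n /andP[/eqP ->]; by rewrite (negPf kN).
have := sum_tail_le 0 K; have := a0_half; lra.
Qed.

(** For each fixed N the coefficients of [lac] in [zr N] are compared with those of a partial sum, K
    being chosen after N; the bound 1 for partial sums is uniform in K and N. *)
Lemma wiener_lac : wiener lac.
Proof.
split; first exact/L2T_L1T/L2T_lac.
apply: nondecreasing_is_cvgn.
  apply/nondecreasing_seqP => N; rewrite big_nat_recr//= lerDl addr_ge0 ?cmod_ge0//.
exists 1 => _ [N _ <-].
rewrite -[leLHS](big_zr N (fun n => cmod (fourier_coef lac n))).
apply/ler_addgt0Pr => e e0.
have h01 : 0 <= (1 / 2 : R) < 1 by apply/andP; split; lra.
have N1 : 0 < (size (zr N))%:R + 1 :> R by rewrite ltr_wpDl.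
have e8 : 0 < e / ((size (zr N))%:R + 1) / 8 by rewrite !divr_gt0.
have [K KP] := @exp_small R _ _ h01 e8.
have aK : 8 * a K <= e / ((size (zr N))%:R + 1).
  by have := a_le_pow K; have := a_gt0 K; rewrite exprS; lra.
have LK := L2T_lac_part K.
have dK n : cmod (fourier_coef lac n) <=
    cmod (fourier_coef (lac_part K) n) + e / ((size (zr N))%:R + 1).
  rewrite -[fourier_coef lac n](subrK (fourier_coef (lac_part K) n)) addrC.
  rewrite (le_trans (cmodD _ _))// lerD2l -fourierB//; last exact: L2T_lac.
  apply: le_trans aK; rewrite (_ : 8 * a K = 2 * (4 * a K)); last by lra.
  apply: cmod_fourier_le => [|t _]; first exact: L2TB L2T_lac LK.
  exact: cmod_lacB.
apply: (le_trans (ler_sum _ (fun n _ => dK n))).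
rewrite big_split /= lerD ?sum_fourier_lac_part//.
rewrite big_const_seq count_predT iter_addr_0 -[leLHS]mulr_natr mulrAC ler_pdivrMr//.
by rewrite ler_pM2l// lerDl.
Qed.

End lacunary.

(** * Measure estimates *)

Section tools.
Context {R : realType}.
Notation mu := (@lebesgue_measure R).
Notation I := (@Tset R).
Implicit Types (f g : R -> R[i]) (E F : set R).

Lemma chebyshev_L2 f (d : R) : L2T f -> 0 < d ->
  measurable (I `&` [set t | (d < cmod (f t))%R]) /\
  (mu (I `&` [set t | (d < cmod (f t))%R]) <= (normsq f / d ^+ 2)%:E)%E.
Proof.
move=> Lf d0; have mT := @measurable_Tset R; have [mf if_] := Lf.
set A := I `&` _.
have mA : measurable A.
  rewrite /A (_ : [set t | (d < cmod (f t))%R] = (fun t => cmod (f t)) @^-1` `]d, +oo[).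
    by apply: (measurable_cmod mf) => //; exact: measurable_itv.
  by apply/seteqP; split => t /=; rewrite in_itv /= andbT.
split => //.
have d20 : 0 < d ^+ 2 by rewrite exprn_gt0.
rewrite EFinM lee_pdivlMr//.
rewrite -[X in (X <= _)%E](_ : (\int[mu]_(t in A) (d ^+ 2)%:E = _)%E); last first.
  by rewrite integral_cst// muleC.
rewrite /normsq /Rintegral fineK; last by apply: integrable_fin_num if_.
apply: (@le_trans _ _ (\int[mu]_(t in A) (cmod (f t) ^+ 2)%:E)%E).
  apply: ge0_le_integral => //.
  - by move=> t _; rewrite lee_fin ltW.
  - apply/measurable_EFinP; apply: measurable_funS (measurable_sqr_cmod mf) => //.
    exact: subIsetl.
  - move=> t [_ /= dt]; rewrite lee_fin; apply: lerXn2r; rewrite ?nnegrE ?cmod_ge0 ?(ltW d0)//.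
    exact: ltW.
apply: ge0_subset_integral => //.
- by apply/measurable_EFinP; exact: measurable_sqr_cmod.
- by move=> t _; rewrite lee_fin sqr_ge0.
- exact: subIsetl.
Qed.

Lemma egorov_Tset (u_ : nat -> R -> R) (v : R -> R) (e : R) :
  (forall n, measurable_fun I (u_ n)) -> measurable_fun I v ->
  {ae mu, forall t, I t -> u_ ^~ t @ \oo --> v t} -> 0 < e ->
  exists B, [/\ measurable B, (mu B < e%:E)%E &
    forall k, 0 < k -> exists N, forall n t, (N <= n)%N -> I t -> ~ B t ->
      `|v t - u_ n t| < k].
Proof.
move=> mu_ mv cu e0.
have mT := @measurable_Tset R.
have [B [mB Be uB]] : exists B, [/\ measurable B, (mu B < e%:E)%E &
    {uniform I `\` B, u_ @ \oo --> v}].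
  by apply: ae_pointwise_almost_uniform => //; exact: mu_Tset_fin.
exists B; split=> // k k0.
have : nbhs (v : {uniform` I `\` B -> R}) [set h | forall y, (I `\` B) y -> `|v y - h y| < k].
  apply/uniform_nbhs; exists [set p | `|p.1 - p.2| < k]; split => //.
  have := entourage_ball (R:=R) R (PosNum k0).
  by rewrite -ball_normE.
by move=> /uB [N _ NP]; exists N => n t Nn It nB; exact: NP.
Qed.

(** The gap arcs are disjoint, lie in F and have length 2 pi / N each; the induction adds one arc at
    a time. *)
Lemma gap_measure E F N (e : R) : (0 < N)%N -> measurable F -> (I `\` F) `<=` E ->
  (mu F <= (2 * pi * e)%:E)%E -> (gap_count E N)%:R <= e * N%:R.
Proof.
move=> N0 mF FE muF; have p0 := @pi2_gt0 R.
have NR : 0 < N%:R :> R by rewrite ltr0n.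
pose x (k : nat) : R := 2 * pi * k%:R / N%:R.
have x_mono k l : (k <= l)%N -> x k <= x l.
  by move=> kl; rewrite ler_pM2r ?invr_gt0// ler_pM2l// ler_nat.
have xS k : x k.+1 - x k = 2 * pi / N%:R.
  by rewrite /x -mulrBl -mulrBr -natrB// subSnn mulr1.
pose G k := F `&` `[x 0%N, x k[%classic.
have mG k : measurable (G k) by apply: measurableI => //; exact: measurable_itv.
have key k : (k <= N)%N ->
    (((\sum_(0 <= j < k | gap E N j) 1)%N%:R * (2 * pi / N%:R))%:E <= mu (G k))%E.
  elim: k => [|k IHk] kN; first by rewrite big_geq// mul0r measure_ge0.
  have {}IHk := IHk (ltnW kN).
  have GS : G k `<=` G k.+1.
    move=> t [Ft]; rewrite /= in_itv /= => /andP[t0 tk]; split => //=.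
    by rewrite in_itv /= t0 (lt_le_trans tk)// x_mono.
  rewrite big_mkcond big_nat_recr//= -big_mkcond /=.
  case: ifPn => gk; last first.
    rewrite addn0; apply: (le_trans IHk).
    by apply: le_measure => //; rewrite inE; exact: mG.
  pose A := `[x k, x k.+1[%classic : set R.
  have mA : measurable A by exact: measurable_itv.
  have muA : mu A = (2 * pi / N%:R)%:E.
    have xlt : x k < x k.+1 by rewrite -subr_gt0 xS divr_gt0.
    by rewrite /A lebesgue_measure_itv /= lte_fin xlt -EFinB xS.
  have GA : G k `|` A `<=` G k.+1.
    move=> t [/GS//|]; rewrite /A /= in_itv /= => /andP[tk tk1]; split => /=; last first.
      by rewrite in_itv /= tk1 (le_trans _ tk)// x_mono.
    apply: contrapT => nF; have /asboolP := gk => /(_ t) H; apply: H; last by rewrite tk tk1.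
    apply: FE; split => //; rewrite /Tset /= in_itv /=; apply/andP; split.
      by apply: le_trans tk; rewrite /x divr_ge0// mulr_ge0// ltW.
    rewrite ltW// (lt_le_trans tk1)//; rewrite ler_pdivrMr// ler_pM2l//.
    by rewrite ler_nat.
  have dGA : [disjoint G k & A].
    apply/disj_setPS => t [[_]]; rewrite /A /= !in_itv /= => /andP[_ t1] /andP[t2 _].
    by have := lt_le_trans t1 t2; rewrite ltxx.
  apply: (@le_trans _ _ (mu (G k `|` A))); last first.
    by apply: le_measure => //; rewrite inE; (exact: mG || exact: (measurableU _ _ (mG k) mA)).
  rewrite measureU; [|exact: mG|exact: mA|exact/eqP].
  rewrite natrD mulrDl mul1r EFinD; apply: leeD => //.
  by rewrite le_eqVlt; apply/orP; left; apply/eqP/esym; exact: muA.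
have h : (mu (G N) <= (2 * pi * e)%:E)%E.
  apply: le_trans muF; apply: le_measure; last exact: subIsetl.
    by rewrite inE; exact: mG.
  by rewrite inE.
have := le_trans (key N (leqnn N)) h; rewrite lee_fin mulrA ler_pdivrMr//.
by rewrite mulrC -[leRHS]mulrA ler_pM2l.
Qed.

(** With A = 1000 n the right side decays like exp(-n) and the second term on the left like
    exp(-2n), so a large n wins. Then beta makes 4 beta half of the right side. *)
Lemma exists_constants (B u a : R) : 0 <= B -> 0 < a -> exists A beta,
  [/\ 0 <= A, 0 < beta & Num.max (4 * beta) (4 * ((B + a + 1) * expR (- (A / 500)))) <
      a * expR (- (2 * (u + A * (1 / 2000))))].
Proof.
move=> B0 a0; have C0 : 0 < B + a + 1 by rewrite ltr_wpDl// addr_ge0// ltW.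
have [n nP] := nat_ge (4 * (B + a + 1) * expR (2 * u) / a).
have eA : expR (- (2 * (u + 1000 * n%:R * (1 / 2000)))) = expR (- (2 * u)) * expR (- n%:R) :> R.
  rewrite -expRD; congr expR; clear; lra.
have eA2 : expR (- (1000 * n%:R / 500)) = expR (- n%:R) * expR (- n%:R) :> R.
  by rewrite -expRD; congr expR; clear; lra.
exists (1000 * n%:R), (a * (expR (- (2 * u)) * expR (- n%:R)) / 8); split.
- by apply: mulr_ge0; exact: ler0n.
- by rewrite divr_gt0// mulr_gt0// mulr_gt0 ?expR_gt0.
rewrite eA eA2 gt_max; apply/andP; split.
  have : 0 < a * (expR (- (2 * u)) * expR (- n%:R)) by rewrite mulr_gt0// mulr_gt0 ?expR_gt0.
  move: (a * _) => x; clear; lra.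
have en0 : 0 < expR (- n%:R) :> R by exact: expR_gt0.
rewrite !mulrA ltr_pM2r//.
have enn : n%:R < expR n%:R :> R.
  by apply: lt_le_trans (expR_ge1Dx _); rewrite ltrDr.
rewrite (expRN n%:R) ltr_pdivrMr ?expR_gt0// (expRN (2 * u)).
rewrite ler_pdivrMr// in nP.
rewrite mulrAC ltr_pdivlMr ?expR_gt0// (le_lt_trans nP)// mulrC ltr_pM2l//.
Qed.

Lemma zr_shift (V : nmodType) (F : int -> V) m :
  \sum_(n <- zr m) F n = \sum_(j < m + m) F (j%:Z - m%:Z).
Proof.
rewrite big_zr big_split /= -(big_mkord xpredT (fun j => F (j%:Z - m%:Z))).
rewrite [RHS](@big_cat_nat _ _ _ m)/=; [|exact: leq0n|exact: leq_addr].
rewrite addrC; congr (_ + _).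
  rewrite big_nat_rev /= !big_nat; apply: eq_bigr => j /andP[_ jm].
  by congr F; lia.
rewrite -{2}[m]add0n big_addn addnK; apply: eq_bigr => j _.
by congr F; lia.
Qed.

End tools.

(** * One stage of the contradiction *)

Section stage.
Context {R : realType}.
Implicit Types (E : set R).

(** Rotating the vertex to 1 reduces this to [abel_bound], and 12 = 1 + 11. *)
Lemma psum_cone (c : nat -> R[i]) N (M : R) t z : 0 <= M ->
  (forall K, cmod (psum c K t) <= M) -> cmod z < 1 ->
  cmod (z - expi 1 t) <= 11 * (1 - cmod z) ->
  cmod (\sum_(i < N) c i * z ^+ i) <= 12 * M.
Proof.
move=> M0 cM z1 zt; pose w := z * expi (-1) t.
have cw : cmod w = cmod z by rewrite cmodM cmod_expi mulr1.
have zw : z = w * expi 1 t.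
  by rewrite /w -mulrA -expiD addNr expi0 mulr1.
have -> : \sum_(i < N) c i * z ^+ i = \sum_(i < N) (c i * expi i%:Z t) * w ^+ i.
  by apply: eq_bigr => i _; rewrite zw exprMn expi_nat; ring.
have w1 : cmod w < 1 by rewrite cw.
have bM k : cmod (\sum_(i < k) c i * expi i%:Z t) <= M.
  by have := cM k; rewrite /psum big_mkord.
apply: le_trans (abel_bound (b := fun i => c i * expi i%:Z t) N M0 w1 bM) _.
rewrite mulrC ler_wpM2r//.
have -> : cmod (1 - w) = cmod (z - expi 1 t).
  have -> : z - expi 1 t = (w - 1) * expi 1 t by rewrite mulrBl mul1r -zw.
  by rewrite cmodM cmod_expi mulr1 cmodB.
have d0 : 0 < 1 - cmod w by rewrite subr_gt0.
have : cmod (z - expi 1 t) / (1 - cmod w) <= 11 by rewrite ler_pdivrMr// cw.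
move: (_ / _) => x; clear; lra.
Qed.

Lemma stage_estimate (c : nat -> R[i]) (hh : int -> R[i]) (a : nat -> R) (nu : nat -> nat)
    E N m k (M u beta A : R) :
  (forall i, 0 < a i) -> (forall i, a i.+1 <= a i / 2) -> a 0%N <= 1 / 2 ->
  (forall i, (i < k)%N -> (nu i < nu k)%N) -> (m < nu k)%N ->
  0 <= M -> 0 < beta -> 0 <= A ->
  (forall t, E t -> forall K, cmod (psum c K t) <= M) ->
  (forall t, E t ->
     cmod (psum c N t + trig hh (zr m) t - lac_part a nu k.+1 t) <= beta) ->
  \sum_(n <- zr m) cmod (hh n) ^+ 2 <= u ->
  (forall L, (0 < L)%N -> (gap_count E L)%:R <= 1 / 2000 * L%:R :> R) ->
  a k * expR (- (2 * (u + A * (1 / 2000)))) <=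
    Num.max (4 * beta) (4 * ((12 * M + 2 + a k + 1) * expR (- (A / 500)))).
Proof.
move=> a0 ah ah0 nuk mk M0 beta0 A0 cM Pb hu gapE.
set n := nu k in nuk mk.
pose S : {poly R[i]} := \sum_(i < N) (c i)%:P * 'X^i.
pose b (j : nat) : R[i] := hh (j%:Z - m%:Z).
pose Q : {poly R[i]} := \sum_(j < m + m) (b j)%:P * 'X^j.
pose G : {poly R[i]} := \sum_(i < k) ((a i)%:C)%:P * 'X^(n - nu i).
pose P := 'X^n * S + 'X^(n - m) * Q - G.
have SE z : S.[z] = \sum_(i < N) c i * z ^+ i.
  by rewrite horner_sum; apply: eq_bigr => i _; rewrite hornerM hornerC hornerXn.
have QE z : Q.[z] = \sum_(j < m + m) b j * z ^+ j.
  by rewrite horner_sum; apply: eq_bigr => i _; rewrite hornerM hornerC hornerXn.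
have GE z : G.[z] = \sum_(i < k) (a i)%:C * z ^+ (n - nu i).
  by rewrite horner_sum; apply: eq_bigr => i _; rewrite hornerM hornerC hornerXn.
have PE z : P.[z] = z ^+ n * S.[z] + z ^+ (n - m) * Q.[z] - G.[z].
  by rewrite /P hornerD hornerN hornerD !hornerM !hornerXn.
have [q [q_ge q0]] := sqr_majorant (m + m) b.
have q_nneg z : cmod z <= 1 -> 0 <= complex.Re q.[z].
  by move=> z1; rewrite (le_trans _ (q_ge z z1))// sqr_ge0.
set u' := \sum_(j < m + m) cmod (b j) ^+ 2 in q0.
have u'u : u' <= u.
  by apply: le_trans hu; rewrite (zr_shift (fun i => cmod (hh i) ^+ 2)).
(* All exponents n, n - m and n - nu_i are positive; here the frequency must exceed both the degree
   of Q and the earlier frequencies. *)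
have P0 : P.[0] = 0.
  have n0 : (0 < n)%N by exact: leq_ltn_trans mk.
  have nm0 : (0 < n - m)%N by rewrite subn_gt0.
  rewrite PE GE !expr0n (gtn_eqF n0) (gtn_eqF nm0).
  rewrite !mul0r add0r big1 ?subr0// => i _.
  by rewrite expr0n subn_eq0 leqNgt nuk// mulr0.
have sum_a : \sum_(i < k) a i <= 1.
  rewrite -(big_mkord xpredT a); have := sum_tail_le a0 ah 0 k; lra.
have absP z : cmod z <= 1 -> cmod P.[z] <= cmod S.[z] + cmod Q.[z] + 1.
  move=> z1; have z0 := cmod_ge0 z.
  have zle (e : nat) w : cmod (z ^+ e * w) <= cmod w.
    by rewrite cmodM cmodX ler_piMl ?cmod_ge0// exprn_ile1.
  rewrite PE (le_trans (cmodBD _ _))// lerD//.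
    by rewrite (le_trans (cmodD _ _))// lerD.
  rewrite GE; apply: le_trans sum_a; rewrite (le_trans (cmod_sum _ _ _))// ler_sum// => i _.
  by rewrite mulrC (le_trans (zle _ _))// ger0_cmod// ltW.
have PE_circle t : P.[expi 1 t] - (a k)%:C =
    expi n%:Z t * (psum c N t + trig hh (zr m) t - lac_part a nu k.+1 t).
  have E1 : S.[expi 1 t] = psum c N t.
    rewrite SE /psum big_mkord; apply: eq_bigr => i _; by rewrite [in RHS]expi_nat.
  have E2 : expi 1 t ^+ (n - m) * Q.[expi 1 t] = expi n%:Z t * trig hh (zr m) t.
    rewrite QE /trig zr_shift !mulr_sumr; apply: eq_bigr => j _.
    rewrite -!expi_nat mulrCA [RHS]mulrCA -!expiD; congr (_ * expi _ _).
    by move: mk; clear; lia.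
  have E3 : G.[expi 1 t] + (a k)%:C = expi n%:Z t * lac_part a nu k.+1 t.
    rewrite GE /lac_part big_nat_recr//= mulrDr big_mkord mulr_sumr; congr (_ + _).
      apply: eq_bigr => i _; rewrite -expi_nat mulrCA -expiD; congr (_ * expi _ _).
      by have := nuk i (ltn_ord i); clear; lia.
    by rewrite -/n mulrCA expi_mulN mulr1.
  rewrite PE E1 E2 -expi_nat mulrBr -E3; ring.
have Pcirc t : E t -> cmod (P.[expi 1 t] - (a k)%:C) <= beta.
  by move=> Et; rewrite PE_circle cmodM cmod_expi mul1r Pb.
have Pcone t z : E t -> cmod z < 1 -> cmod (z - expi 1 t) <= 11 * (1 - cmod z) ->
    cmod P.[z] <= (12 * M + 2) + complex.Re q.[z].
  move=> Et z1 zt; rewrite (le_trans (absP z (ltW z1)))//.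
  have h1 : cmod S.[z] <= 12 * M by rewrite SE; exact: psum_cone (cM t Et) z1 zt.
  have h2 := q_ge z (ltW z1); rewrite -QE in h2.
  (* Turns |Q| into 1 plus its harmonic majorant. This 1 and the bound 1 for [G] form the 2 in 12 M
     + 2. *)
  have h3 : cmod Q.[z] <= 1 + cmod Q.[z] ^+ 2.
    by have := sqr_ge0 (cmod Q.[z] - 1); have := cmod_ge0 Q.[z]; move: (cmod Q.[z]) => x; clear; nra.
  move: h1 h2 h3; clear; lra.
have B0 : 0 <= 12 * M + 2 by move: M0; clear; lra.
have eps_le : 1 / 2000 <= 1 / 500 :> R by clear; lra.
have := two_constants (a0 k) beta0 B0 A0 eps_le P0 Pcirc Pcone q_nneg q0 gapE.
apply: le_trans; rewrite ler_pM2l// ler_expR lerN2; move: u'u; clear; lra.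
Qed.

End stage.

(** * The theorem *)

Section choices.
Context {R : realType}.

(** The last condition makes the tail of the series after index k, at most 4 a_(k+1), a quarter of
    the accuracy [b k (a k)] demanded at stage k. *)
Lemma exists_amplitudes (b : nat -> R -> R) : (forall k x, 0 < x -> 0 < b k x) ->
  exists a : nat -> R, [/\ forall k, 0 < a k, forall k, a k.+1 <= a k / 2,
    a 0%N <= 1 / 2 & forall k, 4 * a k.+1 <= b k (a k) / 4].
Proof.
move=> b0; pose a := fix F k : R :=
  if k is k'.+1 then Num.min (F k') (b k' (F k')) / 16 else 1 / 2.
have aS k : a k.+1 = Num.min (a k) (b k (a k)) / 16 by [].
have a_gt0 k : 0 < a k.
  elim: k => [|k IHk]; first by rewrite /= divr_gt0.
  by rewrite aS divr_gt0// lt_min IHk b0.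
have half (x y : R) : 0 < y -> x <= y -> x / 16 <= y / 2 by clear; lra.
have quarter (x y : R) : x <= y -> 4 * (x / 16) <= y / 4 by clear; lra.
exists a; split => // k; rewrite aS.
  by apply: half => //; rewrite ge_min lexx.
by apply: quarter; rewrite ge_min lexx orbT.
Qed.

Lemma exists_frequencies (m : nat -> nat) : exists nu : nat -> nat,
  (forall k, (m k < nu k)%N) /\ forall i k, (i < k)%N -> (nu i < nu k)%N.
Proof.
pose nu := fix F k := if k is k'.+1 then (maxn (F k') (m k)).+1 else (m 0%N).+1.
exists nu; split=> [[|k]//=|]; first by rewrite ltnS leq_maxr.
apply: (@homo_ltn _ nu (fun x y => (x < y)%N)) => [y x z|k]; first exact: ltn_trans.
by rewrite /= ltnS leq_maxl.
Qed.

End choices.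

(** * Tails of the Fourier coefficients of a function in [H_omega] *)

Section tails.
Context {R : realType}.
Variables (omega : nat -> R) (h : R -> R[i]).
Hypothesis omega_pos : forall n, 0 < omega n.
Hypothesis omega_mono : {homo omega : m n / (m <= n)%N >-> m <= n}.
Hypothesis Hh : H_omega omega h.

(** S is the full weighted sum; by monotonicity the weights of all frequencies beyond m are at least
    omega(m)^2. *)
Lemma H_omega_tail : exists2 S : R, 0 <= S & forall m J,
  \sum_(m <= k < J) (cmod (fourier_coef h k%:Z) ^+ 2 +
     cmod (fourier_coef h (- k.+1%:Z)) ^+ 2) <= S / omega m ^+ 2.
Proof.
pose w (n : int) := cmod (fourier_coef h n) ^+ 2 * omega `|n|%N ^+ 2.
pose s (N : nat) := \sum_(0 <= k < N) (w k%:Z + w (- k.+1%:Z)).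
have cs : cvgn s by case: Hh.
have w0 n : 0 <= w n by rewrite mulr_ge0 ?sqr_ge0.
have nds : nondecreasing_seq s.
  by apply/nondecreasing_seqP => N; rewrite /s big_nat_recr//= lerDl addr_ge0.
have sle N : s N <= limn s by exact: nondecreasing_cvgn_le.
exists (limn s) => [|m J]; first by apply: le_trans (sle 0%N); rewrite /s big_geq.
rewrite ler_pdivlMr ?exprn_gt0// mulr_suml.
have [Jm|mJ] := leqP J m; first by rewrite big_geq//; apply: le_trans (sle 0%N); rewrite /s big_geq.
apply: le_trans (sle J); rewrite /s (@big_cat_nat _ _ _ m 0 J)//=; last exact: ltnW.
rewrite -[leLHS]add0r lerD ?sumr_ge0// => [k _|]; first by rewrite addr_ge0.
rewrite !big_nat; apply: ler_sum => k /andP[mk _]; rewrite mulrDl.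
have om l : (m <= l)%N -> omega m ^+ 2 <= omega l ^+ 2.
  by move=> ml; apply: lerXn2r; rewrite ?nnegrE ?(ltW (omega_pos _))// omega_mono.
rewrite /w; apply: lerD; rewrite ler_wpM2l ?sqr_ge0// om//=.
exact: leqW.
Qed.

End tails.

Theorem theorem1 (R : realType) (omega : nat -> R)
  (omega_pos : forall n, 0 < omega n)
  (omega_mono : {homo omega : m n / (m <= n)%N >-> m <= n})
  (omega_infty : omega @ \oo --> +oo) :
  exists f : R -> R[i],
    wiener f /\
    forall g h : R -> R[i], PLA g -> H_omega omega h ->
      ~ {ae muT, forall t, Tset t -> f t = g t + h t}.
Proof.
pose B (k : nat) : R := 12 * k%:R + 2.
have B0 k : 0 <= B k by rewrite addr_ge0// mulr_ge0.
(* The accuracy is a function of k and the amplitude alone, with k standing for both unknown bounds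
   M and u; it must exist before g and h are introduced. *)
have [beta betaP] : {beta : nat * R -> R & forall p, 0 < p.2 -> 0 < beta p /\ exists2 A, 0 <= A &
    Num.max (4 * beta p) (4 * ((B p.1 + p.2 + 1) * expR (- (A / 500)))) <
      p.2 * expR (- (2 * (p.1%:R + A * (1 / 2000))))}.
  apply: (choice (P := fun p b => 0 < p.2 -> 0 < b /\ exists2 A, 0 <= A &
    Num.max (4 * b) (4 * ((B p.1 + p.2 + 1) * expR (- (A / 500)))) <
      p.2 * expR (- (2 * (p.1%:R + A * (1 / 2000)))))) => -[k x].
  have [x0|x0] := boolP (0 < x); last by exists 0.
  have [A [b [A0 b0 h]]] := exists_constants k%:R (B0 k) x0.
  by exists b => _; split => //; exists A.
have [a [a0 ah ah0 a4]] := exists_amplitudes (b := fun k x => beta (k, x))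
  (fun k x x0 => (betaP (k, x) x0).1).
pose be k := beta (k, a k).
have be0 k : 0 < be k by have [] := betaP (k, a k) (a0 k).
(* Four exceptional sets of measure at most pi q each must fit in measure 2 pi / 2000. *)
have [q q0 q4] : exists2 q : R, 0 < q & 4 * q <= 2 * (1 / 2000).
  by exists (1 / 4000); clear; lra.
(* Chebyshev at level be_k / 4 bounds the bad set of h - Q by 64 pi S / (omega(m) be_k)^2. Since
   omega(m) be_k >= W (k + 1) and S <= k will hold, 64 <= q W^2 brings this below pi q. *)
have [W W0 WP] : exists2 W : R, 0 < W & 64 <= q * W * W.
  exists (64 / q + 1); first by rewrite addr_gt0// divr_gt0.
  have h : q * (64 / q + 1) = 64 + q by field; rewrite gt_eqF.
  have : 0 <= 64 / q by rewrite divr_ge0// ltW.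
  by rewrite h; move: (64 / q) q0 => x; clear; nra.
have /choice [m mP] : forall k : nat, exists m, W * (k%:R + 1) / be k <= omega m.
  move=> k; have /cvgryPge /(_ (W * (k%:R + 1) / be k)) [N _ /(_ N (leqnn N))] := omega_infty.
  by exists N.
have [nu [mnu nuS]] := exists_frequencies m.
exists (lac a nu); split; first exact: wiener_lac.
move=> g h [mg [c cg]] Hh [N0 [mN0 muN0 N0P]].
have Lh : L2T h by case: Hh.
have [S S0 SP] := H_omega_tail omega_pos omega_mono Hh.
have pi0 := pi_gt0 R.
pose e : R := pi * q.
have e0 : 0 < e by rewrite mulr_gt0.
have mT := @measurable_Tset R.
have Lp K : L2T (psum c K) by apply: L2T_sum => n; apply: L2TZ; exact: L2T_expi.
have mp K : cmeasurable (psum c K) := (Lp K).1.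
have cR : {ae @lebesgue_measure R, forall t, Tset t ->
    (fun K => complex.Re (psum c K t)) @ \oo --> complex.Re (g t)}.
  by apply: negligibleS cg => t /= H gt; apply: H => /gt[].
have cI : {ae @lebesgue_measure R, forall t, Tset t ->
    (fun K => complex.Im (psum c K t)) @ \oo --> complex.Im (g t)}.
  by apply: negligibleS cg => t /= H gt; apply: H => /gt[].
have [B1 [mB1 muB1 uB1]] := egorov_Tset (fun K => (mp K).1) mg.1 cR e0.
have [B2 [mB2 muB2 uB2]] := egorov_Tset (fun K => (mp K).2) mg.2 cI e0.
have gunif x : 0 < x -> exists N, forall n t, (N <= n)%N -> Tset t -> ~ B1 t -> ~ B2 t ->
    cmod (psum c n t - g t) <= x.
  move=> x0; have x20 : 0 < x / 2 by rewrite divr_gt0.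
  have [N1 N1P] := uB1 _ x20; have [N2 N2P] := uB2 _ x20.
  exists (maxn N1 N2) => n t; rewrite geq_max => /andP[n1 n2] It nB1 nB2.
  rewrite cmodB (le_trans (cmod_le_ReIm _))// ReD ImD ReN ImN.
  have := N1P n t n1 It nB1; have := N2P n t n2 It nB2.
  move: (`|complex.Re _ - _|) (`|complex.Im _ - _|) => y z; clear; lra.
have [M0 M0P] : exists M0, 1 <= M0 /\ normsq h / M0 ^+ 2 <= e.
  have [M1 M1P] := nat_ge (normsq h / e); exists (M1%:R + 1).
  have M11 : 1 <= M1%:R + 1 :> R by rewrite lerDr.
  split => //; rewrite ler_pdivrMr ?exprn_gt0//.
  rewrite ler_pdivrMr// in M1P.
  rewrite mulrC (le_trans M1P)// ler_pM2r// expr2.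
  rewrite (@le_trans _ _ (M1%:R + 1))// ?lerDl// ler_peMr//.
case: M0P => M01 M0P; have M00 : 0 < M0 by apply: lt_le_trans ltr01 M01.
have [mB3 muB3] := chebyshev_L2 Lh M00.
set B3 := Tset `&` _ in mB3 muB3.
have [N1 N1P] := gunif 1 ltr01.
(* From index N1 on, a partial sum is within 1 of g = f - h, where |f| <= 2 and |h| <= M0; the
   finitely many earlier ones are bounded by the sum of |c_j|. *)
pose M := 2 + M0 + 1 + \sum_(0 <= j < N1) cmod (c j).
(* The stage is selected only now: k dominates the bound on partial sums, the sum of squared
   coefficients of h (tail from 0), and the constant S hidden in the choice of m_k. *)
have [k kP] : exists k : nat, [/\ M <= k%:R, S / omega 0 ^+ 2 <= k%:R & S <= k%:R].
  have [k kP] := nat_ge (M + S / omega 0 ^+ 2 + S); exists k.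
  have w0 : 0 <= S / omega 0 ^+ 2 by rewrite divr_ge0// sqr_ge0.
  have Mp : 0 <= M.
    by rewrite /M addr_ge0 ?sumr_ge0// => [|j _]; rewrite ?cmod_ge0// !addr_ge0// ltW.
  move: kP w0 S0 Mp; move: (S / _) (k%:R) => x y; clear; split; lra.
case: kP => kM kS0 kS.
have [bek [A A0 AP]] := betaP (k, a k) (a0 k); rewrite -/(be k) /= in bek AP.
have d0 : 0 < be k / 4 by rewrite divr_gt0.
have Q_le : normsq (fun t => h t - trig (fourier_coef h) (zr (m k)) t) / (be k / 4) ^+ 2 <= e.
  have := fourier_tail Lh (L2T_approximable Lh) (SP (m k)).
  set x := normsq _ => hx; rewrite ler_pdivrMr ?exprn_gt0//.
  apply: le_trans hx _.
  have w0 := omega_pos (m k).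
  rewrite mulrA ler_pdivrMr ?exprn_gt0//.
  have := mP k; rewrite ler_pdivrMr// => h1.
  have k0 : 0 <= k%:R :> R by exact: ler0n.
  have h2 : W * (k%:R + 1) * (W * (k%:R + 1)) <= (omega (m k) * be k) * (omega (m k) * be k).
    by apply: ler_pM => //; apply: mulr_ge0; rewrite ?addr_ge0// ltW.
  have h3 : 64 * k%:R <= q * (omega (m k) * be k) ^+ 2.
    apply: (@le_trans _ _ (q * (W * (k%:R + 1) * (W * (k%:R + 1))))); last first.
      by rewrite expr2 ler_pM2l.
    have -> : q * (W * (k%:R + 1) * (W * (k%:R + 1))) = q * W * W * (k%:R + 1) ^+ 2 by ring.
    apply: (@le_trans _ _ (64 * (k%:R + 1) ^+ 2)); last by rewrite ler_wpM2r// sqr_ge0.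
    move: k0; move: (k%:R) => r; clear; nra.
  have -> : 4 * pi * S = pi / 16 * (64 * S) by field.
  have -> : e * (be k / 4) ^+ 2 * omega (m k) ^+ 2 = pi / 16 * (q * (omega (m k) * be k) ^+ 2).
    by rewrite /e; move: (pi : R) => p; field.
  rewrite ler_pM2l ?divr_gt0//; apply: le_trans h3; by rewrite ler_pM2l.
have [mB4 muB4] := chebyshev_L2 (L2TB Lh (L2T_trig (fourier_coef h) (zr (m k)))) d0.
set B4 := Tset `&` _ in mB4 muB4.
pose F := B1 `|` B2 `|` B3 `|` N0 `|` B4.
have mF : measurable F by rewrite /F; do 4 (apply: measurableU => //).
have muF : (@lebesgue_measure R F <= (2 * pi * (1 / 2000))%:E)%E.
  have muU (A1 A2 : set R) (x y : R) : measurable A1 -> measurable A2 ->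
      (@lebesgue_measure R A1 <= x%:E)%E -> (@lebesgue_measure R A2 <= y%:E)%E ->
      (@lebesgue_measure R (A1 `|` A2) <= (x + y)%:E)%E.
    move=> m1 m2 h1 h2; apply: le_trans; first by apply: measureU2.
    by rewrite EFinD leeD.
  have h12 := muU _ _ _ _ mB1 mB2 (ltW muB1) (ltW muB2).
  have mB12 := measurableU _ _ mB1 mB2.
  have h3 : (@lebesgue_measure R B3 <= e%:E)%E by apply: (le_trans muB3); rewrite lee_fin.
  have h123 := muU _ _ _ _ mB12 mB3 h12 h3.
  have mB123 := measurableU _ _ mB12 mB3.
  have h0 : (@lebesgue_measure R N0 <= 0%:E)%E by rewrite le_eqVlt; apply/orP; left; apply/eqP.
  have h1230 := muU _ _ _ _ mB123 mN0 h123 h0.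
  have mB1230 := measurableU _ _ mB123 mN0.
  have h4 : (@lebesgue_measure R B4 <= e%:E)%E by apply: (le_trans muB4); rewrite lee_fin.
  apply: (le_trans (muU _ _ _ _ mB1230 mB4 h1230 h4)); rewrite lee_fin.
  have -> : e + e + e + 0 + e = pi * (4 * q) by rewrite /e; ring.
  by rewrite [leRHS]mulrAC [leRHS]mulrC ler_pM2l.
(* The index of the partial sum entering P depends on k, whereas the exceptional sets [B1] and [B2]
   and the bound M do not. *)
have [N2 N2P] := gunif _ d0.
pose E := Tset `\` F.
have notF t : E t -> [/\ Tset t, ~ B1 t, ~ B2 t & ~ B3 t] /\ (~ N0 t /\ ~ B4 t).
  by move=> [It nF]; split; split => // Bt; apply: nF; rewrite /F /=; tauto.
have cM t : E t -> forall K, cmod (psum c K t) <= k%:R.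
  move=> /notF[[It nB1 nB2 nB3] [nN0 _]] K; apply: le_trans kM; rewrite /M.
  have sum0 N : 0 <= \sum_(0 <= j < N) cmod (c j) by apply: sumr_ge0 => j _; exact: cmod_ge0.
  have M20 : 0 <= 2 + M0 + 1 by rewrite !addr_ge0// ltW.
  have [N1K|KN1] := leqP N1 K.
    rewrite -[leLHS]addr0 lerD// -(subrK (g t) (psum c K t)).
    rewrite (le_trans (cmodD _ _))// addrC lerD//; last exact: N1P.
    have ft : lac a nu t = g t + h t by apply: contrapT => nf; apply: nN0; apply: N0P => /= H; exact: nf (H It).
    have -> : g t = lac a nu t - h t by rewrite ft addrK.
    rewrite (le_trans (cmodBD _ _))// lerD ?cmod_lac// leNgt; apply/negP => hM.
    by apply: nB3; split.
  rewrite -[leLHS]add0r lerD// (le_trans (cmod_sum _ _ _))//.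
  rewrite [leRHS](@big_cat_nat _ _ _ K)//=; last exact: ltnW.
  rewrite -[leLHS]addr0 lerD//; last by apply: sumr_ge0 => j _; exact: cmod_ge0.
  by apply: ler_sum => j _; rewrite cmodM cmod_expi mulr1.
have Pb t : E t -> cmod (psum c N2 t + trig (fourier_coef h) (zr (m k)) t -
    lac_part a nu k.+1 t) <= be k.
  move=> /notF[[It nB1 nB2 nB3] [nN0 nB4]].
  have ft : lac a nu t = g t + h t by apply: contrapT => nf; apply: nN0; apply: N0P => /= H; exact: nf (H It).
  (* Three errors, each at most be_k / 4: convergence to g, the Fourier tail of h, the tail of the
     lacunary series. *)
  have -> : psum c N2 t + trig (fourier_coef h) (zr (m k)) t - lac_part a nu k.+1 t =
    (psum c N2 t - g t) + (trig (fourier_coef h) (zr (m k)) t - h t) +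
    (lac a nu t - lac_part a nu k.+1 t) by rewrite ft; ring.
  have h1 := N2P N2 t (leqnn _) It nB1 nB2.
  have h2 : cmod (trig (fourier_coef h) (zr (m k)) t - h t) <= be k / 4.
    by rewrite cmodB leNgt; apply/negP => hM; apply: nB4; split.
  have h3 : cmod (lac a nu t - lac_part a nu k.+1 t) <= be k / 4.
    by apply: le_trans (a4 k); exact: cmod_lacB.
  rewrite (le_trans (cmodD _ _))// (le_trans (lerD (cmodD _ _) (lexx _)))//.
  move: h1 h2 h3 bek; rewrite -/(be k).
  move: (cmod _) (cmod _) (cmod _) (be k) => x y z b; clear; lra.
have hu : \sum_(n <- zr (m k)) cmod (fourier_coef h n) ^+ 2 <= k%:R.
  by apply: le_trans kS0; rewrite big_zr; exact: SP.
have gapE L : (0 < L)%N -> (gap_count E L)%:R <= 1 / 2000 * L%:R :> R.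
  by move=> L0; apply: (gap_measure L0 mF) => // t.
have k0 : 0 <= k%:R :> R by exact: ler0n.
have := stage_estimate a0 ah ah0 (fun i => nuS i k) (mnu k) k0 bek A0 cM Pb hu gapE.
by move=> /(lt_le_trans AP); rewrite ltxx.
Qed.
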